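(* Let $M$ be a countable model of an $\omega$-categorical theory (in a countable language) which has a canonical independence relation, and let $G=\mathrm{Aut}(M)$. Then $G$ has a cyclically dense conjugacy class. In fact, there is some $f\in G$ such that the set of $g\in G$ for which $\{f^n g f^{-n} : n\in\mathbb{Z}\}$ is dense in $G$ is comeager in $G$. Furthermore, the same is true for $G^n$ (with the product topology) in place of $G$, for any $n<\omega$.
   Context: $\mathrm{Aut}(M)$ carries the topology of pointwise convergence (induced from the product topology on $M^M$ with $M$ discrete). A topological group $G$ has a cyclically dense conjugacy class if there are $f_1,f_2\in G$ such that $\{f_1^{-n}f_2f_1^n : n\in\mathbb{Z}\}$ is dense in $G$. For tuples, $a\equiv b$ means $\mathrm{tp}(a/\emptyset)=\mathrm{tp}(b/\emptyset)$ in $M$, and $a\equiv_C b$ means $\mathrm{tp}(a/C)=\mathrm{tp}(b/C)$. Juxtaposition of sets (e.g. $BC$) denotes union; $A\downarrow B$ means $A\downarrow_\emptyset B$. A ternary relation $A\downarrow_C B$ on finite subsets of a countable structure $M$, invariant under $\mathrm{Aut}(M)$, is a canonical independence relation (CIR) if for all finite $A,B,C,D\subseteq M$: (Stationarity over $\emptyset$) if $A\downarrow B$, $A'\downarrow B'$, $a,b,a',b'$ are tuples enumerating $A,B,A',B'$, and $a\equiv a'$, $b\equiv b'$, then $ab\equiv a'b'$; (Extension on the right) if $A\downarrow_C B$ then for every finite tuple $d$ there is $d'\equiv_{BC}d$ such that $A\downarrow_C B\cup d'$; (Transitivity on both sides) if $A\downarrow_{DC}B$ and $D\downarrow_C B$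 then $AD\downarrow_C B$; and if $A\downarrow_{DC}B$ and $A\downarrow_C D$ then $A\downarrow_C BD$; (Monotonicity) if $A\downarrow_C B$, $A'\subseteq A$, $B'\subseteq B$ then $A'\downarrow_C B'$; (Existence) $A\downarrow_C C$ and $C\downarrow_C A$. (Neither symmetry nor base monotonicity is required.) *)

(* Defs.v *)
From HB Require Import structures.
From mathcomp Require Import all_boot all_order all_algebra finmap.
From mathcomp Require Import boolp classical_sets functions cardinality.
From mathcomp Require Import topology.

Set Implicit Arguments.
Unset Strict Implicit.
Unset Printing Implicit Defensive.

Local Open Scope classical_set_scope.

(* The symbols range over [countType]s: all languages here are countable. *)
Record language := Language {
  fsym : countType;
  farity : fsym -> nat;
  rsym : countType;
  rarity : rsym -> nat
}.

Record structure (L : language) (M : Type) := Structure {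
  fint : forall f : fsym L, (farity f).-tuple M -> M;
  rint : forall r : rsym L, (rarity r).-tuple M -> Prop
}.

Inductive term (L : language) (n : nat) : Type :=
| Var : 'I_n -> term L n
| App : forall f : fsym L, ('I_(farity f) -> term L n) -> term L n.

(* The free variables of [p : formula L n] are among 0, ..., n - 1. In [All p]
   the variable 0 of [p] is bound and the other ones are shifted down by 1. *)
Inductive formula (L : language) : nat -> Type :=
| Falsum : forall n, formula L n
| Equal : forall n, term L n -> term L n -> formula L n
| Rel : forall n (r : rsym L), ('I_(rarity r) -> term L n) -> formula L n
| Imp : forall n, formula L n -> formula L n -> formula L n
| All : forall n, formula L n.+1 -> formula L n.

Definition theory (L : language) := set (formula L 0).

Section Semantics.
Context (L : language) (M : Type) (S : structure L M).

Fixpoint eval n (v : n.-tuple M) (t : term L n) : M :=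
  match t with
  | Var i => tnth v i
  | App f ts => fint S [tuple eval v (ts i) | i < farity f]
  end.

Fixpoint holds n (p : formula L n) : n.-tuple M -> Prop :=
  match p in formula _ n return n.-tuple M -> Prop with
  | Falsum _ => fun=> False
  | Equal _ t u => fun v => eval v t = eval v u
  | Rel _ r ts => fun v => rint S [tuple eval v (ts i) | i < rarity r]
  | Imp _ p q => fun v => holds p v -> holds q v
  | All _ p => fun v => forall x : M, holds p [tuple of x :: v]
  end.

Definition models (T : theory L) : Prop := forall p, T p -> holds p [tuple].

End Semantics.

Definition isomorphism (L : language) (M N : Type)
    (S : structure L M) (R : structure L N) (h : M -> N) : Prop :=
  [/\ bijective h,
      forall (f : fsym L) (x : (farity f).-tuple M),
        h (fint S x) = fint R (map_tuple h x)
    & forall (r : rsym L) (x : (rarity r).-tuple M),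
        rint S x <-> rint R (map_tuple h x)].

Definition omega_categorical (L : language) (T : theory L) : Prop :=
  (exists (N : Type) (S : structure L N),
     ([set: N] #= [set: nat])%card /\ models S T) /\
  (forall (N N' : Type) (S : structure L N) (S' : structure L N'),
     ([set: N] #= [set: nat])%card -> models S T ->
     ([set: N'] #= [set: nat])%card -> models S' T ->
     exists h : N -> N', isomorphism S S' h).

Definition nowhere_dense (X : topologicalType) (A : set X) : Prop :=
  interior (closure A) = set0.

Definition meager (X : topologicalType) (A : set X) : Prop :=
  exists F : nat -> set X,
    (forall i, nowhere_dense (F i)) /\ A = \bigcup_i F i.

Definition comeager (X : topologicalType) (A : set X) : Prop := meager (~` A).

HB.mixin Record isTopologicalGroup G of Group G & Topological G := {
  mulg_continuous : continuous (fun xy : G * G => (xy.1 * xy.2)%g);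
  invg_continuous : continuous (fun x : G => (x^-1)%g)
}.

#[short(type="topologicalGroupType")]
HB.structure Definition TopologicalGroup :=
  {G of Group G & Topological G & isTopologicalGroup G}.

Definition expgz (G : groupType) (x : G) (n : int) : G :=
  match n with
  | Posz k => (x ^+ k)%g
  | Negz k => (x ^- k.+1)%g
  end.

Definition cyclically_dense_conjugacy_class (G : topologicalGroupType) : Prop :=
  exists f1 f2 : G,
    dense [set (expgz f1 (- n)%R * f2 * expgz f1 n)%g | n in [set: int]].

Section ProductGroup.
Context (I : eqType) (G : topologicalGroupType).
Local Notation GI := {ptws I -> G}.
Implicit Types x y z : GI.

Let one : GI := fun=> 1%g.
Let inv x : GI := fun i => ((x i)^-1)%g.
Let mul x y : GI := fun i => (x i * y i)%g.

Let mulA : associative mul.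
Proof. by move=> x y z; apply/funext => i; exact: mulgA. Qed.
Let mul1 : left_id one mul.
Proof. by move=> x; apply/funext => i; exact: mul1g. Qed.
Let mulr1 : right_id one mul.
Proof. by move=> x; apply/funext => i; exact: mulg1. Qed.
Let mulV : left_inverse one inv mul.
Proof. by move=> x; apply/funext => i; exact: mulVg. Qed.
Let mulrV : right_inverse one inv mul.
Proof. by move=> x; apply/funext => i; exact: mulgV. Qed.

HB.instance Definition _ := isGroup.Build GI mulA mul1 mulr1 mulV mulrV.

End ProductGroup.

Section ProductTopologicalGroup.
Context (I : eqType) (G : topologicalGroupType).
Local Notation GI := {ptws I -> G}.

Lemma continuous_into_ptws (X : topologicalType) (T : topologicalType) (J : Type)
  (h : X -> {ptws J -> T}) :
  (forall j, continuous (fun x => h x j)) -> continuous h.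
Proof.
move=> hc x; apply/cvg_sup => j A [B [[C oC <-] /= Chx] sBA].
apply: (filterS sBA); apply: (hc j x); exact: open_nbhs_nbhs.
Qed.

Lemma ptws_eval_continuous (T : topologicalType) (J : eqType) (j : J) :
  continuous (fun x : {ptws J -> T} => x j).
Proof. exact: (@proj_continuous J (fun=> T)). Qed.

Let mulGI_continuous : continuous (fun xy : GI * GI => (xy.1 * xy.2)%g).
Proof.
apply: continuous_into_ptws => i xy.
apply: (@continuous_comp _ _ _ (fun xy : GI * GI => (xy.1 i, xy.2 i))
          (fun xy : G * G => (xy.1 * xy.2)%g)); last exact: mulg_continuous.
apply: cvg_pair.
- apply: (@continuous_comp _ _ _ fst (fun x : GI => x i)); first exact: cvg_fst.
  exact: ptws_eval_continuous.
- apply: (@continuous_comp _ _ _ snd (fun x : GI => x i)); first exact: cvg_snd.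
  exact: ptws_eval_continuous.
Qed.

Let invGI_continuous : continuous (fun x : GI => (x^-1)%g).
Proof.
apply: continuous_into_ptws => i x.
apply: (@continuous_comp _ _ _ (fun x : GI => x i) (fun x : G => (x^-1)%g)).
- exact: ptws_eval_continuous.
- exact: invg_continuous.
Qed.

HB.instance Definition _ :=
  isTopologicalGroup.Build GI mulGI_continuous invGI_continuous.

End ProductTopologicalGroup.

Section Aut.
Context (L : language) (M : choiceType) (S : structure L M).

Local Notation ptwsM := {ptws M -> discrete_topology M}.

Definition automorphisms : set ptwsM := [set f | isomorphism S S f].

Definition Aut : Type := set_type automorphisms.

HB.instance Definition _ := Topological.copy Aut (set_type automorphisms).

Definition aut_fun (f : Aut) : M -> M := set_val f.
Coercion aut_fun : Aut >-> Funclass.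

Lemma autP (f : Aut) : isomorphism S S f.
Proof. exact: (set_mem (valP f)). Qed.

Definition mkAut (f : M -> M) (fP : isomorphism S S f) : Aut :=
  SigSub (mem_set fP : f \in automorphisms).

Lemma autE (f g : Aut) : f =1 g -> f = g.
Proof. by move=> fg; apply: val_inj; apply/funext. Qed.

Lemma isomorphism_id : isomorphism S S id.
Proof.
split; first by exists id.
- by move=> f x; congr fint; apply: eq_from_tnth => i; rewrite tnth_map.
- by move=> r x; rewrite (_ : map_tuple id x = x) //;
    apply: eq_from_tnth => i; rewrite tnth_map.
Qed.

Lemma isomorphism_comp (f g : Aut) : isomorphism S S (f \o g).
Proof.
have [fb ff fr] := autP f; have [gb gf gr] := autP g.
have cE n (x : n.-tuple M) :
    map_tuple (f \o g) x = map_tuple f (map_tuple g x).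
  by apply: eq_from_tnth => i; rewrite !tnth_map.
split; first exact: bij_comp.
- by move=> h x; rewrite /= gf ff cE.
- by move=> r x; rewrite gr fr cE.
Qed.

Definition aut_inv_fun (f : Aut) : M -> M :=
  let: And3 fb _ _ := autP f in
  sval (cid (let: Bijective g gf fg := fb in
             ex_intro (fun g => cancel f g /\ cancel g f) g (conj gf fg))).

Lemma aut_inv_funP (f : Aut) : cancel f (aut_inv_fun f) /\ cancel (aut_inv_fun f) f.
Proof. by rewrite /aut_inv_fun; case: (autP f) => fb _ _; case: cid. Qed.

Lemma isomorphism_inv (f : Aut) : isomorphism S S (aut_inv_fun f).
Proof.
have [fb ff fr] := autP f; have [gf fg] := aut_inv_funP f.
have cE n (x : n.-tuple M) :
    map_tuple f (map_tuple (aut_inv_fun f) x) = x.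
  by apply: eq_from_tnth => i; rewrite !tnth_map fg.
split; first by exists f.
- by move=> h x; apply: (can_inj gf); rewrite fg ff cE.
- by move=> r x; rewrite [X in _ <-> X]fr cE.
Qed.

Let one : Aut := mkAut isomorphism_id.
Let mul (f g : Aut) : Aut := mkAut (isomorphism_comp f g).
Let inv (f : Aut) : Aut := mkAut (isomorphism_inv f).

Let mulA : associative mul. Proof. by move=> f g h; apply: autE. Qed.
Let mul1 : left_id one mul. Proof. by move=> f; apply: autE. Qed.
Let mulr1 : right_id one mul. Proof. by move=> f; apply: autE. Qed.
Let mulV : left_inverse one inv mul.
Proof. by move=> f; apply: autE => x; exact: (aut_inv_funP f).1. Qed.
Let mulrV : right_inverse one inv mul.
Proof. by move=> f; apply: autE => x; exact: (aut_inv_funP f).2. Qed.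

HB.instance Definition _ := isGroup.Build Aut mulA mul1 mulr1 mulV mulrV.

Lemma aut_mulE (f g : Aut) (x : M) : (f * g : Aut)%g x = f (g x).
Proof. by []. Qed.

Lemma aut_invK (f : Aut) : cancel f (f^-1 : Aut)%g.
Proof. exact: (aut_inv_funP f).1. Qed.

Lemma near_aut (f : Aut) (x : M) : \forall g \near f, aut_fun g x = f x.
Proof.
have c : continuous (fun g : Aut => (g : ptwsM) x).
  move=> g; apply: (@continuous_comp Aut ptwsM (discrete_topology M)
                      (fun g : Aut => (g : ptwsM)) (fun h => h x)).
    exact: initial_continuous.
  exact: ptws_eval_continuous.
exact: (c f [set f x : discrete_topology M] (discrete_set1 _)).
Qed.

Lemma continuous_into_Aut (X : topologicalType) (h : X -> Aut) :
  (forall x y, \forall z \near x, h z y = h x y) -> continuous h.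
Proof.
move=> hP; apply: (@continuous_comp_initial _ X ptwsM
  (@set_val ptwsM automorphisms) h).
apply: continuous_into_ptws => y x A Ax.
apply: filterS (hP x y) => z /= hz.
rewrite /= -[set_val (h z) y]/(h z y) hz; exact: nbhs_singleton Ax.
Qed.

Let mulAut_continuous : continuous (fun fg : Aut * Aut => (fg.1 * fg.2)%g).
Proof.
apply: continuous_into_Aut => -[f g] x.
exists ([set f' : Aut | aut_fun f' (aut_fun g x) = aut_fun f (aut_fun g x)],
        [set g' : Aut | aut_fun g' x = aut_fun g x]).
  by split; exact: near_aut.
by move=> [f' g'] /= [e1 e2]; rewrite !aut_mulE e2.
Qed.

Let invAut_continuous : continuous (fun f : Aut => (f^-1)%g).
Proof.
apply: continuous_into_Aut => f x.
apply: filterS (near_aut f ((f^-1 : Aut)%g x)) => g e.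
have fK : aut_fun f ((f^-1 : Aut)%g x) = x by exact: (aut_inv_funP f).2.
by rewrite -{1}fK -e aut_invK.
Qed.

HB.instance Definition _ :=
  isTopologicalGroup.Build Aut mulAut_continuous invAut_continuous.

End Aut.

Section Independence.
Context (L : language) (M : choiceType) (S : structure L M).
Local Open Scope fset_scope.

(* Formulas p(x, c) in an n-tuple x of variables, with parameters c. *)
Definition param_formula (n : nat) : Type :=
  {m : nat & (formula L (n + m) * m.-tuple M)%type}.

Definition tp (C : {fset M}) n (a : n.-tuple M) : set (param_formula n) :=
  [set q : param_formula n | let: existT m (p, c) := q in
     {subset c <= C} /\ holds S p [tuple of a ++ c]].

Definition eqtp (C : {fset M}) n (a b : n.-tuple M) : Prop := tp C a = tp C b.

Definition enumerates n (a : n.-tuple M) (A : {fset M}) : Prop := a =i A.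

(* [ind A C B] stands for: A is independent from B over C. *)
Record canonical_independence_relation
    (ind : {fset M} -> {fset M} -> {fset M} -> Prop) : Prop := {
  cir_invariant : forall (g : Aut S) A C B,
    ind A C B -> ind (g @` A) (g @` C) (g @` B);
  cir_stationarity : forall A B A' B' n m
      (a a' : n.-tuple M) (b b' : m.-tuple M),
    ind A fset0 B -> ind A' fset0 B' ->
    enumerates a A -> enumerates b B -> enumerates a' A' -> enumerates b' B' ->
    eqtp fset0 a a' -> eqtp fset0 b b' ->
    eqtp fset0 [tuple of a ++ b] [tuple of a' ++ b'];
  cir_extension : forall A B C n (d : n.-tuple M),
    ind A C B ->
    exists d' : n.-tuple M, eqtp (B `|` C) d' d /\
      ind A C (B `|` [fset x in tval d']);
  cir_transitivity_left : forall A B C D,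
    ind A (D `|` C) B -> ind D C B -> ind (A `|` D) C B;
  cir_transitivity_right : forall A B C D,
    ind A (D `|` C) B -> ind A C D -> ind A C (B `|` D);
  cir_monotonicity : forall A A' B B' C,
    ind A C B -> A' `<=` A -> B' `<=` B -> ind A' C B';
  cir_existence : forall A C, ind A C C /\ ind C C A
}.

Definition has_CIR : Prop := exists ind, canonical_independence_relation ind.

End Independence.

(* Main.v *)
(** Homogeneity. If the type of a tuple [a] of an infinite [M] were not
    isolated, forcing with formulas that are satisfied by injective sequences
    [nat -> M] would give a model of [T] with universe [nat] omitting it,
    against categoricity; so every type realized in [M] is isolated, and back
    and forth turns [a ≡ b] into an automorphism taking [a] to [b].

    A repulsive automorphism. Build [s] by finite approximations with finite
    sets [W 0 = fset0], [W i ∪ s(W i) ⊆ W (i+1)] and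
    [W (i+1) ↓_{s(W i)} s(W (i+1))]. Transitivity on both sides gives
    [W (j+r) ↓_{s^r(W j)} s^r(W m)] for [j + r <= m], hence
    [W r ↓ s^r(W r)]. Forward steps enlarge the domain of the approximation;
    backward steps are forward steps seen after a shift by [s], and make [s]
    surjective. So for every finite [A] there is [r] with [A ↓ s^r(A)].

    Generic conjugates. Given an automorphism [u], a finite set [E] and a basic
    open set [{h | h x = b x for x in P}] containing [b], take [r] with
    [Z ↓ s^r(Z)] for a finite [Z] containing [E], [u(E)], [P], [b(P)].
    Stationarity and homogeneity give [k] that agrees with [u] on [E] and with
    [s^r b s^-r] on [s^r(P)], so that [s^-r k s^r] is in the open set. As the
    same [r] serves finitely many [u] and [b] at once, this works in powers. *)
Require Import Defs.
From HB Require Import structures.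
From mathcomp Require Import all_boot all_order all_algebra finmap.
From mathcomp Require Import boolp classical_sets functions cardinality.
From mathcomp Require Import topology.

Set Implicit Arguments.
Unset Strict Implicit.
Unset Printing Implicit Defensive.

Local Open Scope classical_set_scope.

(** * Formulas, definable sets and types *)

Section Renaming.
Context (L : language).

Fixpoint tren n m (r : 'I_n -> 'I_m) (t : term L n) : term L m :=
  match t with
  | Var i => Var L (r i)
  | App f ts => App (f := f) (fun i => tren r (ts i))
  end.

(** The renaming used under [All]: the bound variable 0 is fixed, and [r] acts on the others, which
    sit one higher there. *)
Definition lift_ren n m (r : 'I_n -> 'I_m) (i : 'I_n.+1) : 'I_m.+1 :=
  if unlift ord0 i is Some j then lift ord0 (r j) else ord0.

Fixpoint fren n (p : formula L n) : forall m, ('I_n -> 'I_m) -> formula L m :=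
  match p in formula _ n return forall m, ('I_n -> 'I_m) -> formula L m with
  | Falsum _ => fun m _ => Falsum L m
  | Equal _ t u => fun m r => Equal (tren r t) (tren r u)
  | Rel _ s ts => fun m r => Rel (r := s) (fun i => tren r (ts i))
  | Imp _ p q => fun m r => Imp (fren p r) (fren q r)
  | All _ p => fun m r => All (fren p (lift_ren r))
  end.

Context (M : Type) (S : structure L M).

Lemma eval_tren n m (r : 'I_n -> 'I_m) (t : term L n) (v : m.-tuple M) :
  Defs.eval S v (tren r t) = Defs.eval S [tuple tnth v (r i) | i < n] t.
Proof.
elim: t => [i|f ts IH] /=; first by rewrite tnth_mktuple.
by congr fint; apply: eq_from_tnth => i; rewrite !tnth_mktuple IH.
Qed.

Lemma holds_fren n (p : formula L n) m (r : 'I_n -> 'I_m) (v : m.-tuple M) :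
  holds S (fren p r) v <-> holds S p [tuple tnth v (r i) | i < n].
Proof.
elim: p m r v => {n} [n|n t u|n s ts|n p IHp q IHq|n p IH] m r v //=.
- by rewrite !eval_tren.
- suff -> : [tuple Defs.eval S v (tren r (ts i)) | i < rarity s] =
    [tuple Defs.eval S [tuple tnth v (r i) | i < n] (ts i) | i < rarity s] by [].
  by apply: eq_from_tnth => i; rewrite !tnth_mktuple eval_tren.
- by rewrite IHp IHq.
- suff E x : [tuple tnth [tuple of x :: v] (lift_ren r i) | i < n.+1] =
     [tuple of x :: [tuple tnth v (r i) | i < n]].
    by split=> H x; have := H x; rewrite IH E.
  apply: eq_from_tnth => i; rewrite tnth_mktuple /lift_ren.
  by case: unliftP => [j|] ->; rewrite ?tnth0 // !tnthS tnth_mktuple.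
Qed.

End Renaming.

Section FormulaCountable.
Context (L : language).

(** Finite trees over [nat] form a countable type, so these codes let the forcing requirements be
    enumerated. Arguments given as functions on ordinals become lists. *)
Fixpoint tcode n (t : term L n) : GenTree.tree nat :=
  match t with
  | Var i => GenTree.Leaf (i : nat)
  | App f ts => GenTree.Node (choice.pickle f)
      [seq tcode (ts i) | i <- enum 'I_(farity f)]
  end.

(** [Falsum] and the atomic formulas store [n], so that a code determines the number of variables;
    [Imp] and [All] recover it from their subformulas. *)
Fixpoint fcode n (p : formula L n) : GenTree.tree nat :=
  match p with
  | Falsum n => GenTree.Node 0 [:: GenTree.Leaf n]
  | Equal n t u => GenTree.Node 1 [:: GenTree.Leaf n; tcode t; tcode u]
  | Rel n s ts => GenTree.Node 2 [:: GenTree.Leaf n; GenTree.Leaf (choice.pickle s);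
      GenTree.Node 0 [seq tcode (ts i) | i <- enum 'I_(rarity s)]]
  | Imp n p q => GenTree.Node 3 [:: fcode p; fcode q]
  | All n p => GenTree.Node 4 [:: fcode p]
  end.

Lemma eq_in_enum (T : Type) k (F G : 'I_k -> T) :
  [seq F i | i <- enum 'I_k] = [seq G i | i <- enum 'I_k] -> F =1 G.
Proof.
move=> E i; move/(congr1 (fun s => nth (F i) s i)): E.
by rewrite (nth_map i _ F) ?(nth_map i _ G) ?size_enum_ord // nth_ord_enum.
Qed.

Lemma pickle_inj (T : countType) : injective (@choice.pickle T).
Proof. exact: pcan_inj choice.pickleK. Qed.

Lemma tcode_inj n : injective (@tcode n).
Proof.
elim=> [i|f ts IH] [j|g us] //=; first by case=> /val_inj ->.
case=> /pickle_inj E; subst g => /eq_in_enum E.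
by congr App; apply/funext => i; apply: IH; exact: E.
Qed.

(** An equality of dependent pairs, because the induction has to recover the number of variables
    together with the formula. *)
Lemma fcode_inj n (p : formula L n) m (q : formula L m) :
  fcode p = fcode q -> existT (formula L) n p = existT (formula L) m q.
Proof.
elim: p m q => {n} [n|n t u|n s ts|n p IHp q IHq|n p IH] m0
  [m|m t' u'|m s' ts'|m p' q'|m p'] //=.
- by case=> ->.
- by case=> E; subst m => /tcode_inj -> /tcode_inj ->.
- case=> E; subst m => /pickle_inj E; subst s' => /eq_in_enum E.
  by congr existT; congr Rel; apply/funext => i; apply: tcode_inj; exact: E.
- case=> /IHp E /IHq; have /= E' := congr1 (@projT1 _ _) E; subst m.
  by move=> E'; rewrite (@eq_from_Tagged nat _ _ _ _ E)
    (@eq_from_Tagged nat _ _ _ _ E').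
- case=> /IH E; have [E'] := congr1 (@projT1 _ _) E; subst m.
  by rewrite (@eq_from_Tagged nat _ _ _ _ E).
Qed.

End FormulaCountable.

Section Definable.
Context (L : language) (M : Type) (S : structure L M).

Definition definable n (P : n.-tuple M -> Prop) : Prop :=
  exists p : formula L n, forall v, holds S p v <-> P v.

Definition elem_equiv n (a b : n.-tuple M) : Prop :=
  forall p : formula L n, holds S p a <-> holds S p b.

Lemma eq_definable n (P Q : n.-tuple M -> Prop) :
  (forall v, P v <-> Q v) -> definable P -> definable Q.
Proof. by move=> PQ [p hp]; exists p => v; rewrite hp. Qed.

Lemma definable_holds n (p : formula L n) : definable (holds S p).
Proof. by exists p. Qed.

Lemma definable_false n : definable (fun _ : n.-tuple M => False).
Proof. by exists (Falsum L n). Qed.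

Lemma definable_imp n (P Q : n.-tuple M -> Prop) :
  definable P -> definable Q -> definable (fun v => P v -> Q v).
Proof.
by move=> [p hp] [q hq]; exists (Imp p q) => v /=; rewrite hp hq.
Qed.

Lemma definable_not n (P : n.-tuple M -> Prop) :
  definable P -> definable (fun v => ~ P v).
Proof. by move=> dP; apply: definable_imp => //; exact: definable_false. Qed.

Lemma definable_and n (P Q : n.-tuple M -> Prop) :
  definable P -> definable Q -> definable (fun v => P v /\ Q v).
Proof.
move=> dP dQ; apply: (@eq_definable _ (fun v => ~ (P v -> ~ Q v))); last first.
  by apply: definable_not; apply: definable_imp => //; exact: definable_not.
move=> v; split=> [H|[Pv Qv] /(_ Pv)//].
by apply: contrapT => nPQ; apply: H => Pv Qv; apply: nPQ.
Qed.

Lemma definable_all_seq n (T : eqType) (s : seq T) (P : T -> n.-tuple M -> Prop) :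
  (forall t, definable (P t)) ->
  definable (fun v => forall t, t \in s -> P t v).
Proof.
move=> dP; elim: s => [|t s IH].
  apply: (@eq_definable _ (fun=> ~ False)); first by move=> v; split=> // _ [].
  by apply: definable_not; exact: definable_false.
apply: eq_definable (definable_and (dP t) IH) => v; split=> [[Pt Ps] u|H].
  by rewrite inE => /orP[/eqP ->|/Ps].
by split=> [|u us]; apply: H; rewrite inE ?eqxx ?us ?orbT.
Qed.

Lemma definable_cons n (P : n.+1.-tuple M -> Prop) :
  definable P -> definable (fun v => exists x, P [tuple of x :: v]).
Proof.
move=> dP; have [p hp] := definable_not dP.
apply: (@eq_definable _ (fun v => ~ forall x, ~ P [tuple of x :: v])).
  by move=> v; rewrite not_existsP.
apply: definable_not; exists (All p) => v /=.
by split=> H x; apply/hp.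
Qed.

Lemma definable_ren n m (r : 'I_n -> 'I_m) (P : n.-tuple M -> Prop) :
  definable P -> definable (fun v => P [tuple tnth v (r i) | i < n]).
Proof. by move=> [p hp]; exists (fren p r) => v; rewrite holds_fren hp. Qed.

Lemma definable_eq n (i j : 'I_n) : definable (fun v => tnth v i = tnth v j).
Proof. by exists (Equal (Var L i) (Var L j)). Qed.

Lemma definable_cat n m (P : (m + n).-tuple M -> Prop) :
  definable P -> definable (fun v => exists w : m.-tuple M, P [tuple of w ++ v]).
Proof.
elim: m P => [|m IH] P dP.
  apply: eq_definable dP => v; split=> [Pv|[w]].
    by exists [tuple]; congr P: Pv; exact: val_inj.
  by congr P; apply: val_inj; rewrite /= tuple0.
apply: eq_definable (IH _ (definable_cons dP)) => v; split=> [[w [x Pv]]|[w Pv]].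
  by exists [tuple of x :: w]; congr P: Pv; exact: val_inj.
exists [tuple of behead w], (thead w); congr P: Pv; apply: val_inj => /=.
by rewrite {1}(tuple_eta w).
Qed.

(** Through its graph, a function symbol is handled by formulas alone: this gives the values of
    functions in the generic model, and shows that elementary bijections commute with [fint]. *)
Lemma definable_graph (f : Defs.fsym L) :
  exists q : formula L (farity f).+1, forall (v : (farity f).-tuple M) y,
    holds S q [tuple of y :: v] <-> fint S v = y.
Proof.
exists (Equal (App (f := f) (fun i => Var L (lift ord0 i))) (Var L ord0)) => v y /=.
set u := mktuple _; suff -> : u = v by [].
by apply: eq_from_tnth => i; rewrite tnth_mktuple tnthS.
Qed.

Lemma elem_equiv_definable n (a b : n.-tuple M) (P : n.-tuple M -> Prop) :
  elem_equiv a b -> definable P -> P a <-> P b.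
Proof. by move=> ab [p hp]; rewrite -!hp. Qed.

Lemma elem_equiv_sym n (a b : n.-tuple M) : elem_equiv a b -> elem_equiv b a.
Proof. by move=> ab p; rewrite ab. Qed.

Lemma elem_equiv_trans n (a b c : n.-tuple M) :
  elem_equiv a b -> elem_equiv b c -> elem_equiv a c.
Proof. by move=> ab bc p; rewrite ab. Qed.

Lemma elem_equiv_ren n m (r : 'I_n -> 'I_m) (a b : m.-tuple M) :
  elem_equiv a b ->
  elem_equiv [tuple tnth a (r i) | i < n] [tuple tnth b (r i) | i < n].
Proof. by move=> ab p; rewrite -!holds_fren. Qed.

Lemma nelem_equiv n (a b : n.-tuple M) : ~ elem_equiv a b ->
  exists p : formula L n, holds S p a /\ ~ holds S p b.
Proof.
move=> /existsNP [p np].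
have [pa|npa] := pselect (holds S p a).
  by exists p; split=> // pb; apply: np.
exists (Imp p (Falsum L n)); split=> //= npb; by apply: np.
Qed.

End Definable.

Section Isomorphism.
Context (L : language).

Lemma eval_iso (M N : Type) (S : structure L M) (R : structure L N) h n
    (t : term L n) (v : n.-tuple M) : isomorphism S R h ->
  h (Defs.eval S v t) = Defs.eval R (map_tuple h v) t.
Proof.
move=> [_ hf _]; elim: t => [i|f ts IH] /=; first by rewrite tnth_map.
by rewrite hf; congr fint; apply: eq_from_tnth => i; rewrite tnth_map !tnth_mktuple.
Qed.

Lemma holds_iso (M N : Type) (S : structure L M) (R : structure L N) h n
    (p : formula L n) (v : n.-tuple M) : isomorphism S R h ->
  holds S p v <-> holds R p (map_tuple h v).
Proof.
move=> hiso; have [[g hK gK] _ hr] := hiso.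
elim: p v => {n} [n|n t u|n s ts|n p IHp q IHq|n p IH] v //=.
- by rewrite -!(eval_iso _ _ hiso); split=> [->//|/(can_inj hK)].
- rewrite hr; suff -> : map_tuple h [tuple Defs.eval S v (ts i) | i < rarity s] =
    [tuple Defs.eval R (map_tuple h v) (ts i) | i < rarity s] by [].
  by apply: eq_from_tnth => i; rewrite tnth_map !tnth_mktuple (eval_iso _ _ hiso).
- by rewrite IHp IHq.
- have E x : map_tuple h [tuple of x :: v] = [tuple of h x :: map_tuple h v].
    exact: val_inj.
  split=> H x; last by rewrite IH E.
  by have := H (g x); rewrite IH E gK.
Qed.

End Isomorphism.

Section Types.
Context (L : language) (M : choiceType) (S : structure L M).
Local Open Scope fset_scope.

Lemma elem_equiv_aut (g : Aut S) n (a : n.-tuple M) :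
  elem_equiv S a (map_tuple g a).
Proof. by move=> p; exact: (holds_iso p a (autP g)). Qed.

Lemma eqtpP (C : {fset M}) n (a b : n.-tuple M) : eqtp S C a b <->
  forall m (c : m.-tuple M), {subset c <= C} ->
    elem_equiv S [tuple of a ++ c] [tuple of b ++ c].
Proof.
split=> [ab m c cC p|ab].
  have /(congr1 (fun A => A (existT _ m (p, c)))) /= := ab.
  rewrite /tp /= => E; split=> H.
    by have [] : {subset c <= C} /\ holds S p [tuple of b ++ c] by rewrite -E.
  by have [] : {subset c <= C} /\ holds S p [tuple of a ++ c] by rewrite E.
apply/seteqP; split=> -[m [p c]] [cC H]; split=> //.
  by rewrite -(ab m c cC).
by rewrite (ab m c cC).
Qed.

Lemma eqtp0P n (a b : n.-tuple M) : eqtp S fset0 a b <-> elem_equiv S a b.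
Proof.
rewrite eqtpP; split=> [ab|ab m c c0].
  have /(elem_equiv_ren (lshift 0)) := ab 0 [tuple] (fun x => id).
  set a' := mktuple _; set b' := mktuple _.
  suff -> : a' = a; first suff -> : b' = b by [].
    by apply: eq_from_tnth => i; rewrite tnth_mktuple tnth_lshift.
  by apply: eq_from_tnth => i; rewrite tnth_mktuple tnth_lshift.
(* Parameters from the empty set form the empty tuple, so only the cast between [n + 0] and [n]
   remains. *)
case: m c c0 => [c _|m c /(_ (thead c))]; last first.
  by rewrite mem_tnth in_fset0 => /(_ isT).
have := elem_equiv_ren (cast_ord (addn0 n)) ab.
set a' := mktuple _; set b' := mktuple _.
have E (d : n.-tuple M) :
    [tuple tnth d (cast_ord (addn0 n) i) | i < n + 0] = [tuple of d ++ c].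
  apply: eq_from_tnth => i; rewrite tnth_mktuple -[i in RHS]splitK.
  case: splitP => [j ij|[//]] /=.
  by rewrite tnth_lshift; congr tnth; exact: val_inj.
by rewrite /a' /b' !E.
Qed.

End Types.

(** * Omitting types *)

Lemma fresh_nat (s : seq nat) : exists k : nat, k \notin s.
Proof.
exists (\max_(i <- s) i).+1; apply/negP => ks.
by have := @leq_bigmax_seq _ s xpredT id _ ks isT; rewrite ltnn.
Qed.

Lemma infinite_injection (T : Type) (A : set T) : infinite_set A ->
  exists e : nat -> T, injective e /\ forall n, A (e n).
Proof.
move=> /infiniteP/card_leP[e].
exists (fun n => set_val (e (SigSub (mem_setT n)))); split=> [m n|n]; last first.
  exact: set_valP.
move=> /val_inj /(inj (mem_setT _) (mem_setT _)) E.
exact: (congr1 (fun z => set_val z) E).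
Qed.

Lemma extend_injective (M : Type) (s : seq nat) (w : nat -> M) :
  infinite_set [set: M] -> {in s &, injective w} ->
  exists x : nat -> M, injective x /\ {in s, x =1 w}.
Proof.
move=> Minf winj.
have : infinite_set ([set: M] `\` (w @` [set` s])).
  by apply: infinite_setD => //; apply: finite_image; exact: finite_seq.
move=> /infinite_injection[e [einj es]].
have eNw i j : j \in s -> e i <> w j.
  by move=> js E; have [_] := es i; apply; exists j.
exists (fun k => if k \in s then w k else e k); split=> [i j|i ->//].
case: ifPn => is_; case: ifPn => js.
- exact: winj.
- by move=> /esym/eNw; case.
- by move=> /eNw; case.
- exact: einj.
Qed.

Section OmittingTypes.
Context (L : language) (M : Type) (S : structure L M).
Hypothesis Minf : infinite_set [set: M].

Implicit Types (C D : (nat -> M) -> Prop) (x : nat -> M).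

Definition inst n (p : formula L n) (r : n.-tuple nat) x : Prop :=
  holds S p (map_tuple x r).

Definition fin_def C : Prop :=
  exists n (p : formula L n) (r : n.-tuple nat), forall x, C x <-> inst p r x.

(** The forcing conditions. Injectivity makes distinct indices name distinct elements, so that the
    generic model has universe [nat] with no quotient to take. *)
Definition good C : Prop := fin_def C /\ exists x, injective x /\ C x.

Lemma fin_def_inst n (p : formula L n) r : fin_def (inst p r).
Proof. by exists n, p, r. Qed.

Lemma fin_def_not C : fin_def C -> fin_def (fun x => ~ C x).
Proof.
move=> [n [p [r h]]]; exists n, (Imp p (Falsum L n)), r => x.
by rewrite /inst /= h.
Qed.

Lemma tnth_cat_lshift T m n (u : m.-tuple T) (v : n.-tuple T) :
  [tuple tnth [tuple of u ++ v] (lshift n i) | i < m] = u.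
Proof. by apply: eq_from_tnth => i; rewrite tnth_mktuple tnth_lshift. Qed.

Lemma tnth_cat_rshift T m n (u : m.-tuple T) (v : n.-tuple T) :
  [tuple tnth [tuple of u ++ v] (rshift m i) | i < n] = v.
Proof. by apply: eq_from_tnth => i; rewrite tnth_mktuple tnth_rshift. Qed.

Lemma map_tuple_cat A T m n (f : A -> T) (u : m.-tuple A) (v : n.-tuple A) :
  map_tuple f [tuple of u ++ v] = [tuple of map_tuple f u ++ map_tuple f v].
Proof. by apply: val_inj; rewrite /= map_cat. Qed.

Lemma fin_def_and C D : fin_def C -> fin_def D -> fin_def (fun x => C x /\ D x).
Proof.
move=> [n [p [r h]]] [m [q [s k]]].
have [u hu] := definable_and
  (definable_ren (fun i => lshift m i) (definable_holds S p))
  (definable_ren (fun i => rshift n i) (definable_holds S q)).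
exists (n + m), u, [tuple of r ++ s] => x.
by rewrite /inst hu map_tuple_cat tnth_cat_lshift tnth_cat_rshift h k.
Qed.

(** If [y] is not a value of [x], it is placed at a fresh coordinate, outside [s] and the indices
    that [C] depends on; injectivity survives because [y] is new. *)
Lemma witness C x (s : seq nat) y : fin_def C -> injective x -> C x ->
  exists x' k, [/\ injective x', C x', {in s, x' =1 x} & x' k = y].
Proof.
move=> [n [p [r h]]] xinj Cx.
have [[k xk]|ny] := pselect (exists k, x k = y); first by exists x, k.
have [k] := fresh_nat (s ++ r); rewrite mem_cat negb_or => /andP[ks kr].
exists (fun i => if i == k then y else x i), k; split.
- move=> i j; have [->|_] := eqVneq i k; have [->|_] := eqVneq j k => //.
  + by move=> yE; case: ny; exists j.
  + by move=> yE; case: ny; exists i.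
  + exact: xinj.
- move: Cx; rewrite !h /inst; congr holds; apply: val_inj => /=.
  by apply/eq_in_map => i ir; case: eqVneq ir kr => // -> ->.
- by move=> i si; case: eqVneq si ks => // -> ->.
- by rewrite eqxx.
Qed.

(** Take an injective [x] satisfying [C]. If it satisfies [All q], this is added to [C]; if not,
    [witness] puts a counterexample at some coordinate [k] without changing [x] on [r]. *)
Lemma henkin_dense n (q : formula L n.+1) (r : n.-tuple nat) C : good C ->
  exists D, [/\ good D, forall x, D x -> C x &
    (forall x, D x -> inst (All q) r x) \/
    (exists k, forall x, D x -> ~ inst q [tuple of k :: r] x)].
Proof.
move=> [Cdef [x [xinj Cx]]]; set A := inst (All q) r.
have Adef : fin_def A by exact: fin_def_inst.
have [Ax|nAx] := pselect (A x).
  exists (fun x => C x /\ A x); split=> [|z [] //|]; last by left=> z [].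
  by split; [exact: fin_def_and|exists x].
have [y ny] : exists y, ~ holds S q [tuple of y :: map_tuple x r].
  by apply/existsNP.
have [x' [k [x'inj Cx' x'x x'k]]] := witness r y Cdef xinj Cx.
exists (fun x => C x /\ ~ inst q [tuple of k :: r] x).
split=> [|z []//|]; last by right; exists k => z [].
split.
  exact: fin_def_and Cdef (fin_def_not (fin_def_inst q _)).
exists x'; split=> //; split=> //; congr (~ holds S q _): ny.
apply: val_inj; rewrite /= x'k; congr cons.
by apply/eq_in_map => i ir; rewrite x'x.
Qed.

(** Only the coordinates in [s ++ r] matter: a tuple with the same coincidences as [s ++ r] extends
    to an injective sequence. The quantifier over sequences thus becomes one over finite tuples. *)
Lemma definable_restriction C n (r : n.-tuple nat) : fin_def C ->
  definable S (fun v => exists x, [/\ injective x, C x & map_tuple x r = v]).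
Proof.
move=> [m [p [s h]]]; pose t := [tuple of s ++ r].
pose iffeq (ij : 'I_(m + n) * 'I_(m + n)) (u : (m + n).-tuple M) :=
  tnth u ij.1 = tnth u ij.2 <-> tnth t ij.1 = tnth t ij.2.
have diff ij : definable S (iffeq ij).
  have [E|/eqP E] := eqVneq (tnth t ij.1) (tnth t ij.2).
    by apply: eq_definable (definable_eq S ij.1 ij.2) => u; rewrite /iffeq E; tauto.
  apply: eq_definable (definable_not (definable_eq S ij.1 ij.2)) => u.
  by rewrite /iffeq; tauto.
have dall := definable_all_seq (enum [set: 'I_(m + n) * 'I_(m + n)]%SET) diff.
have dp := definable_ren (fun i => lshift n i) (definable_holds S p).
apply: eq_definable (definable_cat (definable_and dall dp)) => v.
split=> [[w [Hall Hp]]|[x [xinj Cx <-]]]; last first.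
  exists (map_tuple x s); split.
    move=> ij _; rewrite /iffeq -map_tuple_cat -/t !tnth_map.
    by split=> [/xinj|->].
  by rewrite tnth_cat_lshift -/(inst p s x) -h.
set u := [tuple of w ++ v] in Hall Hp.
have pat i j : tnth u i = tnth u j <-> tnth t i = tnth t j.
  by apply: (Hall (i, j)); rewrite mem_enum inE.
have [m0 _] : [set: M] !=set0.
  by apply/set0P/negP => /eqP E; apply: Minf; rewrite E; exact: finite_set0.
(* The value of [u] at the first position of [k] in [t]; by [pat], any other position gives the same
   value. The default [m0] is reached only outside [t]. *)
pose x0 k := nth m0 u (index k t).
have x0t i : x0 (tnth t i) = tnth u i.
  have It : index (tnth t i) t < m + n.
    by rewrite -[X in _ < X](size_tuple t) index_mem mem_tnth.
  rewrite /x0 -[index _ _]/(nat_of_ord (Ordinal It)) -tnth_nth; apply/pat.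
  by rewrite [LHS](tnth_nth 0) /= nth_index ?mem_tnth.
have x0inj : {in t &, injective x0}.
  by move=> _ _ /tnthP[i ->] /tnthP[j ->]; rewrite !x0t => /pat.
have [x [xinj xx0]] := extend_injective Minf x0inj.
have xt : map_tuple x t = u.
  by apply: eq_from_tnth => i; rewrite tnth_map xx0 ?mem_tnth.
exists x; split=> //.
  rewrite h /inst; congr holds: Hp.
  by rewrite -xt map_tuple_cat tnth_cat_lshift.
rewrite -(tnth_cat_rshift (map_tuple x s) (map_tuple x r)) -map_tuple_cat -/t.
by rewrite xt tnth_cat_rshift.
Qed.

Definition isolated n (a : n.-tuple M) : Prop :=
  exists p : formula L n, holds S p a /\
    forall b, holds S p b -> elem_equiv S a b.

(** If every injective sequence in [C] had the type of [a] on the coordinates [r], the formula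
    defining the possible values there, given by [definable_restriction], would isolate that
    type. *)
Lemma omit_dense n (a : n.-tuple M) (r : n.-tuple nat) C :
  ~ isolated a -> good C ->
  exists D, [/\ good D, forall x, D x -> C x &
    exists p : formula L n, holds S p a /\ forall x, D x -> ~ inst p r x].
Proof.
move=> na [Cdef [x [xinj Cx]]]; apply: contrapT => nD; apply: na.
have aC z : injective z -> C z -> elem_equiv S a (map_tuple z r).
  move=> zinj Cz; apply: contrapT => /nelem_equiv[p [pa npz]]; apply: nD.
  exists (fun x => C x /\ ~ inst p r x).
  split=> [|y []//|]; last by exists p; split=> // y [].
  split; last by exists z.
  exact: fin_def_and Cdef (fin_def_not (fin_def_inst p r)).
have [p hp] := definable_restriction r Cdef.
exists p; split.
  by apply/(aC x xinj Cx)/hp; exists x.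
by move=> b; rewrite hp => -[z [zinj Cz <-]]; exact: aC.
Qed.

(** The Rasiowa-Sikorski argument: the step at [i] meets the requirement with code [i], and keeps
    the condition if there is none. *)
Lemma generic_sequence (J : Type) (X : countType) (code : J -> X)
    (tau : J -> ((nat -> M) -> Prop) -> Prop) :
  injective code ->
  (forall j C, good C ->
     exists D, [/\ good D, forall x, D x -> C x & tau j D]) ->
  exists Cs : nat -> (nat -> M) -> Prop,
    [/\ forall i, good (Cs i), forall i x, Cs i.+1 x -> Cs i x &
        forall j, exists i, tau j (Cs i)].
Proof.
move=> cinj dense_tau.
have /choice[f hf] : forall iC : nat * ((nat -> M) -> Prop),
    exists D, good iC.2 ->
      [/\ good D, forall x, D x -> iC.2 x &
          forall j, choice.pickle (code j) = iC.1 -> tau j D].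
  move=> [i C] /=.
  have [gC|ngC] := pselect (good C); last by exists C.
  have [[j ji]|nj] := pselect (exists j, choice.pickle (code j) = i).
    have [D [gD DC tD]] := dense_tau j C gC; exists D => _; split=> // j'.
    by rewrite -ji => /pickle_inj/cinj ->.
  by exists C => _; split=> // j ji; case: nj; exists j.
have good0 : good (fun=> True).
  split; last by have [x [xinj _]] := infinite_injection Minf; exists x.
  by exists 0, (Imp (Falsum L 0) (Falsum L 0)), [tuple] => x; split=> // _ [].
pose fix Cs i : (nat -> M) -> Prop :=
  if i is i'.+1 then f (i', Cs i') else fun=> True.
have gCs i : good (Cs i) by elim: i => // i /(hf (i, Cs i))[].
exists Cs; split=> // [i x|j].
  by have [_ h _] := hf (i, Cs i) (gCs i); apply: h.
pose n := choice.pickle (code j); exists n.+1.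
by have [_ _ h] := hf (n, Cs n) (gCs n); exact: h.
Qed.

End OmittingTypes.

(** * The model built from a generic sequence of conditions *)

Section GenericModel.
Context (L : language) (M : Type) (S : structure L M).
Context (Cs : nat -> (nat -> M) -> Prop).
Hypothesis Cs_good : forall i, good S (Cs i).
Hypothesis Cs_decr : forall i x, Cs i.+1 x -> Cs i x.
Hypothesis Cs_henkin : forall n (q : formula L n.+1) (r : n.-tuple nat),
  exists i, (forall x, Cs i x -> inst S (All q) r x) \/
    (exists k, forall x, Cs i x -> ~ inst S q [tuple of k :: r] x).

Definition forced (P : (nat -> M) -> Prop) : Prop :=
  exists i, forall x, injective x -> Cs i x -> P x.

Lemma Cs_mono i j x : i <= j -> Cs j x -> Cs i x.
Proof.
move=> /subnK <-; elim: (j - i) => // k IH.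
by rewrite addSn => /Cs_decr.
Qed.

Lemma forced_consistent P : forced P -> exists x, injective x /\ P x.
Proof.
move=> [i Pi]; have [_ [x [xinj Cx]]] := Cs_good i.
by exists x; split=> //; exact: Pi.
Qed.

Lemma forced_imp (P Q : (nat -> M) -> Prop) :
  (forall x, injective x -> P x -> Q x) -> forced P -> forced Q.
Proof. by move=> PQ [i Pi]; exists i => x xinj /(Pi _ xinj); exact: PQ. Qed.

Lemma forced_true (P : (nat -> M) -> Prop) :
  (forall x, injective x -> P x) -> forced P.
Proof. by move=> H; exists 0 => x xinj _; exact: H. Qed.

Lemma forced_and P Q : forced P -> forced Q -> forced (fun x => P x /\ Q x).
Proof.
move=> [i Pi] [j Qj]; exists (maxn i j) => x xinj Cx; split.
  by apply: Pi => //; apply: Cs_mono Cx; exact: leq_maxl.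
by apply: Qj => //; apply: Cs_mono Cx; exact: leq_maxr.
Qed.

Lemma forced_forall (T : finType) (P : T -> (nat -> M) -> Prop) :
  (forall t, forced (P t)) -> forced (fun x => forall t, P t x).
Proof.
move=> H.
have : forced (fun x => forall t, t \in enum T -> P t x).
  elim: (enum T) => [|t s IH]; first exact: forced_true.
  apply: forced_imp (forced_and (H t) IH) => x _ [Pt Ps] u.
  by rewrite inE => /orP[/eqP ->|/Ps].
by apply: forced_imp => x _ Px t; apply: Px; rewrite mem_enum.
Qed.

Lemma forced_decide n (p : formula L n) (r : n.-tuple nat) :
  forced (inst S p r) \/ forced (fun x => ~ inst S p r x).
Proof.
(* The Henkin property for [p] under a quantifier it does not depend on. *)
have E k x : inst S (fren p (lift ord0)) [tuple of k :: r] x <-> inst S p r x.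
  rewrite /inst holds_fren; set u := mktuple _.
  suff -> : u = map_tuple x r by [].
  apply: eq_from_tnth => i; rewrite tnth_mktuple !tnth_map.
  by rewrite tnthS.
have [i [H|[k H]]] := Cs_henkin (fren p (lift ord0)) r; [left|right].
  exists i => x xinj /H /(_ (x 0)) Hx; rewrite -(E 0) /inst.
  by congr holds: Hx; exact: val_inj.
by exists i => x xinj /H; rewrite E.
Qed.

Lemma forced_fun (f : Defs.fsym L) (r : (farity f).-tuple nat) :
  exists k, forced (fun x => fint S (map_tuple x r) = x k).
Proof.
have [q hq] := definable_graph S f.
(* The Henkin property for the negated graph: its universal closure fails at the actual value of
   [f], so the second alternative names this value by a coordinate. *)
have [i [H|[k H]]] := Cs_henkin (Imp q (Falsum L _)) r.
  have [_ [x [xinj Cx]]] := Cs_good i.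
  have /= nq := H x Cx (fint S (map_tuple x r)).
  by case: nq; exact/hq.
exists k, i => x xinj /H nq; apply: contrapT => H'; apply: nq => qk; apply: H'.
by apply/hq; congr holds: qk; exact: val_inj.
Qed.

Definition generic_model : structure L nat := {|
  fint := fun f r => sval (cid (forced_fun r));
  rint := fun s r => forced (fun x => rint S (map_tuple x r)) |}.

Lemma forced_eval n (t : term L n) (r : n.-tuple nat) :
  forced (fun x => Defs.eval S (map_tuple x r) t = x (Defs.eval generic_model r t)).
Proof.
elim: t => [i|f ts IH] /=; first by apply: forced_true => x _; rewrite tnth_map.
case: cid => k /= kP; apply: forced_imp (forced_and kP (forced_forall IH)).
move=> x _ [<- H]; congr fint; apply: eq_from_tnth => i.
by rewrite !tnth_map !tnth_ord_tuple H.
Qed.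

(** The truth lemma. Injectivity settles equality, [forced_decide] settles implication, and the
    Henkin property settles [All]. *)
Lemma forced_holds n (p : formula L n) (r : n.-tuple nat) :
  holds generic_model p r <-> forced (inst S p r).
Proof.
rewrite /inst; elim: p r => {n} [n|n t u|n s ts|n p IHp q IHq|n p IH] r.
- by split=> // /forced_consistent[x []].
- have tu := forced_and (forced_eval t r) (forced_eval u r).
  split=> [/= E|H].
    by apply: forced_imp tu => x _ [-> ->]; rewrite E.
  have [x [xinj [[Et Eu]]]] := forced_consistent (forced_and tu H).
  by rewrite /= Et Eu => /xinj.
- have E := forced_forall (fun i => forced_eval (ts i) r).
  split=> /= H; apply: forced_imp (forced_and E H) => x _ [Ex];
    congr (rint S _); apply: eq_from_tnth => i; by rewrite !tnth_map !tnth_ord_tuple Ex.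
- rewrite /= IHp IHq; split=> [H|H Hp]; last first.
    by apply: forced_imp (forced_and H Hp) => x _ [pq /pq].
  have [/H|] := forced_decide p r; apply: forced_imp => x _ //.
- split=> [H|H k]; last first.
    apply/IH; apply: forced_imp H => x _ /(_ (x k)).
    by congr holds; exact: val_inj.
  have [i [Hi|[k Hi]]] := Cs_henkin p r; first by exists i => x _ /Hi.
  have /IH := H k => /(forced_and (ex_intro _ i (fun x _ => Hi x))).
  by move=> /forced_consistent[x [_ []]].
Qed.

End GenericModel.

(** * Atomicity of denumerable models *)

Section Atomicity.
Context (L : language) (T : theory L) (M : Type) (S : structure L M).
Hypothesis T_categorical : omega_categorical T.
Hypothesis S_models_T : models S T.
Hypothesis M_denumerable : ([set: M] #= [set: nat])%card.

Lemma categorical_atomic n (a : n.-tuple M) : isolated S a.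
Proof.
apply: contrapT => na.
(* The requirements below are of two kinds: the Henkin property of each formula with indices, and
   the omission of the type of [a] at each tuple of indices. *)
have Minf : infinite_set [set: M].
  by apply/infiniteP; move: M_denumerable; rewrite card_eq_le => /andP[].
pose J := ({m & formula L m.+1 * m.-tuple nat} + n.-tuple nat)%type.
pose code (j : J) : (GenTree.tree nat * seq nat) + seq nat :=
  match j with
  | inl (existT m (q, r)) => inl (fcode q, val r)
  | inr r => inr (val r)
  end.
have code_inj : injective code.
  move=> [[m [q r]]|r] [[m' [q' r']]|r'] //=; last by case=> /val_inj ->.
  case=> /fcode_inj E; have /= [E'] := congr1 (@projT1 _ _) E; subst m'.
  by rewrite (@eq_from_Tagged nat _ _ _ _ E) => /val_inj ->.
pose tau (j : J) (C : (nat -> M) -> Prop) : Prop :=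
  match j with
  | inl (existT m (q, r)) => (forall x, C x -> inst S (All q) r x) \/
      (exists k, forall x, C x -> ~ inst S q [tuple of k :: r] x)
  | inr r => exists p : formula L n, holds S p a /\
      forall x, C x -> ~ inst S p r x
  end.
have dtau j C : good S C ->
     exists D, [/\ good S D, forall x, D x -> C x & tau j D].
  by case: j => [[m [q r]]|r]; [exact: henkin_dense|exact: omit_dense].
have [Cs [Cgood Cdecr Ctau]] := generic_sequence Minf code_inj dtau.
have Chen m (q : formula L m.+1) r := Ctau (inl (existT _ m (q, r))).
pose N := generic_model Cgood Chen.
have NT : models N T.
  move=> p /S_models_T Sp; apply/(forced_holds Cgood Cdecr Chen).
  by apply: forced_true => x _; congr holds: Sp; exact: val_inj.
have [h hiso] := T_categorical.2 _ _ S N M_denumerable S_models_T (card_eqxx _) NT.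
(* The isomorphism carries the type of [a] to the indices [map_tuple h a], where the omission
   requirement forces some formula of that type to fail. *)
have [i [p [pa np]]] := Ctau (inr (map_tuple h a)).
have /(forced_holds Cgood Cdecr Chen) := (holds_iso p a hiso).1 pa.
move=> /(forced_and Cdecr (ex_intro _ i (fun x _ => np x))).
by move=> /(forced_consistent Cgood)[x [_ []]].
Qed.

End Atomicity.

Section OneStep.
Context (L : language) (T : theory L) (M : countType) (S : structure L M).
Hypothesis T_categorical : omega_categorical T.
Hypothesis S_models_T : models S T.

Lemma elem_equiv_extend n (a b : n.-tuple M) c : elem_equiv S a b ->
  exists d, elem_equiv S [tuple of c :: a] [tuple of d :: b].
Proof.
(* Categoricity concerns denumerable models only. In a finite [M], the conjunction of formulas
   separating [c] from each candidate [d] replaces the isolating formula. *)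
move=> ab; have [Mfin|Minf] := pselect (finite_set [set: M]).
  apply: contrapT => nd.
  have /choice[p hp] : forall d, exists p : formula L n.+1,
      holds S p [tuple of c :: a] /\ ~ holds S p [tuple of d :: b].
    by move=> d; apply: nelem_equiv => H; apply: nd; exists d.
  have [F FM] := finite_fsetP.1 Mfin.
  have dall := definable_all_seq F (fun d => definable_holds S (p d)).
  have /(elem_equiv_definable ab (definable_cons dall))[d] :
      exists x, forall d, d \in F -> holds S (p d) [tuple of x :: a].
    by exists c => d _; have [] := hp d.
  move=> /(_ d) pd; have [_ npd] := hp d; apply: npd; apply: pd.
  have : [set: M] d by [].
  by rewrite FM.
have Mden : ([set: M] #= [set: nat])%card.
  by rewrite card_eq_le; apply/andP; split; [exact: countableP|exact/infiniteP].
have [p [pca piso]] :=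
  categorical_atomic T_categorical S_models_T Mden [tuple of c :: a].
have /(elem_equiv_definable ab (definable_cons (definable_holds S p)))[d pd] :
    exists x, holds S p [tuple of x :: a] by exists c.
by exists d; exact: piso.
Qed.

End OneStep.

(** * Homogeneity *)

Lemma common_index (T : finType) (P : T -> nat -> Prop) :
  (forall t i j, i <= j -> P t i -> P t j) -> (forall t, exists i, P t i) ->
  exists i, forall t, P t i.
Proof.
move=> mono /choice[f hf]; exists (\max_t f t) => t.
exact: mono (leq_bigmax t) (hf t).
Qed.

Section LimitAut.
Context (L : language) (M : choiceType) (S : structure L M).

(** Single-valuedness and injectivity of [G] come for free: they are preservation of the formula
    equating two variables. *)
Lemma limit_aut (G : M -> M -> Prop) :
  (forall x, exists y, G x y) -> (forall y, exists x, G x y) ->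
  (forall n (a b : n.-tuple M), (forall i, G (tnth a i) (tnth b i)) ->
     elem_equiv S a b) ->
  exists g : Aut S, forall x, G x (g x).
Proof.
move=> /choice[g gG] /choice[h hG] Gel.
have gel n (a : n.-tuple M) : elem_equiv S a (map_tuple g a).
  by apply: Gel => i; rewrite tnth_map.
have Gfun x y x' y' : G x y -> G x' y' -> x = x' <-> y = y'.
  move=> Gxy Gxy'; have E : elem_equiv S [tuple x; x'] [tuple y; y'].
    by apply: Gel => -[[|[|]]].
  exact: (elem_equiv_definable E (definable_eq S ord0 (lift ord0 ord0))).
have giso : isomorphism S S g.
  split.
  - exists h => x; first by apply/(Gfun _ _ _ _ (hG _) (gG x)).
    by apply/(Gfun _ _ _ _ (gG _) (hG x)).
  - move=> f a; have [q hq] := definable_graph S f.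
    have /hq Hq : fint S a = fint S a by [].
    apply/esym; rewrite -hq.
    have := (gel _ [tuple of fint S a :: a] q).1 Hq.
    by congr holds; exact: val_inj.
  - move=> r a; have := gel _ a (Rel (r := r) (fun i => Var L i)).
    by rewrite /=; set u := mktuple _; set v := mktuple _;
      have -> : u = a by [apply: eq_from_tnth => i; rewrite tnth_mktuple];
      have -> : v = map_tuple g a by [apply: eq_from_tnth => i; rewrite tnth_mktuple].
by exists (mkAut giso) => x; exact: gG.
Qed.

(** Finite partial elementary maps are represented by full automorphisms [g i], of which only the
    restriction to [E i] counts. *)
Lemma chain_limit_aut (g : nat -> Aut S) (E : nat -> {fset M}) :
  (forall i, {subset E i <= E i.+1}) ->
  (forall i x, x \in E i -> g i.+1 x = g i x) ->
  (forall x, exists i, x \in E i) ->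
  (forall y, exists i x, x \in E i /\ g i x = y) ->
  exists f : Aut S, forall i x, x \in E i -> f x = g i x.
Proof.
move=> Esub gE Etot Esurj.
have mono i j x : i <= j -> x \in E i -> x \in E j /\ g j x = g i x.
  move=> /subnK <- xi; elim: (j - i) => // k [xk gk].
  by rewrite addSn gE // (Esub _ _ xk).
pose G x y := exists i, x \in E i /\ g i x = y.
have [| |n a b Gab|f fG] := @limit_aut G.
- by move=> x; have [i xi] := Etot x; exists (g i x), i.
- by move=> y; have [i [x ?]] := Esurj y; exists x, i.
- have [|i hi] := @common_index _ _ _ Gab.
    by move=> t i j /mono H [/H[? gj] <-].
  suff -> : b = map_tuple (g i) a by exact: elem_equiv_aut.
  by apply: eq_from_tnth => j; rewrite tnth_map; have [_ ->] := hi j.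
exists f => i x xi; have [j [xj <-]] := fG x.
by case/orP: (leq_total i j) => /mono H; [have [_ ->] := H x xi|have [_ ->] := H x xj].
Qed.

End LimitAut.

Section Homogeneity.
Context (L : language) (M : countType) (S : structure L M).
Hypothesis extend : forall n (a b : n.-tuple M) c, elem_equiv S a b ->
  exists d, elem_equiv S [tuple of c :: a] [tuple of d :: b].

Let pelem (s : seq (M * M)) : Prop :=
  elem_equiv S (map_tuple fst (in_tuple s)) (map_tuple snd (in_tuple s)).

Let pelem_step s (c : M) : pelem s ->
  exists d e, pelem [:: (c, d), (e, c) & s].
Proof.
move=> sel.
have [e /elem_equiv_sym he] := extend c (elem_equiv_sym sel).
have {}he : pelem ((e, c) :: s).
  by congr (elem_equiv S _ _): he; exact: val_inj.
have [d hd] := extend c he; exists d, e.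
by congr (elem_equiv S _ _): hd; exact: val_inj.
Qed.

Lemma homogeneous n (a b : n.-tuple M) : elem_equiv S a b ->
  exists g : Aut S, map_tuple g a = b.
Proof.
move=> ab.
(* Step [i] adds the element with code [i] to both the domain and the range. *)
have /choice[step hstep] : forall is_ : nat * seq (M * M), exists s',
    pelem is_.2 -> [/\ pelem s', {subset is_.2 <= s'} &
      forall c, choice.unpickle is_.1 = Some c ->
        (exists d, (c, d) \in s') /\ (exists e, (e, c) \in s')].
  move=> [i s] /=; have [sel|nsel] := pselect (pelem s); last by exists s.
  case: choice.unpickle => [c|]; last by exists s => _; split.
  have [d [e h]] := pelem_step c sel; exists [:: (c, d), (e, c) & s] => _.
  split=> // [x xs|c' [<-]]; first by rewrite !inE xs !orbT.
  by split; [exists d|exists e]; rewrite !inE eqxx ?orbT.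
pose fix s i := if i is i'.+1 then step (i', s i') else zip a b.
have s0 : pelem (s 0).
  have sz : size (zip a b) = n by rewrite size1_zip !size_tuple.
  have := elem_equiv_ren (cast_ord sz) ab; congr (elem_equiv S _ _);
    apply: eq_from_tnth => i; rewrite tnth_mktuple tnth_map /=.
  - have x0 := tnth a (cast_ord sz i).
    rewrite (tnth_nth (x0, x0)) (tnth_nth x0) /= nth_zip ?size_tuple //.
  - have x0 := tnth a (cast_ord sz i).
    rewrite (tnth_nth (x0, x0)) (tnth_nth x0) /= nth_zip ?size_tuple //.
have sel i : pelem (s i) by elim: i => // i /(hstep (i, s i))[].
have ssub i : {subset s i <= s i.+1} by have [] := hstep (i, s i) (sel i).
have smono i j : i <= j -> {subset s i <= s j}.
  move=> /subnK <-; elim: (j - i) => // k IH x /IH.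
  by rewrite addSn; exact: ssub.
have scov c : exists i, (exists d, (c, d) \in s i) /\ (exists e, (e, c) \in s i).
  exists (choice.pickle c).+1.
  have [_ _] := hstep (choice.pickle c, s (choice.pickle c)) (sel _); apply.
  exact: choice.pickleK.
have [| |m x y Gxy|g gG] := @limit_aut _ _ S (fun x y => exists i, (x, y) \in s i).
- by move=> x; have [i [[d ?] _]] := scov x; exists d, i.
- by move=> x; have [i [_ [d ?]]] := scov x; exists d, i.
- have [|i hi] := @common_index _ _ _ Gxy; first by move=> t i j /smono; apply.
  have ilt j : index (tnth x j, tnth y j) (s i) < size (s i) by rewrite index_mem.
  have := elem_equiv_ren (fun j => Ordinal (ilt j)) (sel i).
  congr (elem_equiv S _ _); apply: eq_from_tnth => j; rewrite tnth_mktuple tnth_map.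
  - by rewrite (tnth_nth (tnth x j, tnth y j)) /= nth_index.
  - by rewrite (tnth_nth (tnth x j, tnth y j)) /= nth_index.
(* [limit_aut] only places the graph of [g] inside the union of the [s i]; single-valuedness of that
   union identifies [g] on [a] with the initial pairs [zip a b]. *)
have Gfun x y y' i j : (x, y) \in s i -> (x, y') \in s j -> y = y'.
  move=> xy xy'.
  have k : (x, y) \in s (maxn i j) by apply: smono xy; exact: leq_maxl.
  have k' : (x, y') \in s (maxn i j) by apply: smono xy'; exact: leq_maxr.
  move: k k'; rewrite -!index_mem => k k'.
  have E := elem_equiv_definable (sel (maxn i j))
    (definable_eq S (Ordinal k) (Ordinal k')).
  move: E; rewrite !tnth_map !(tnth_nth (x, y)) /= !nth_index -?index_mem //.
  by move=> -[H _]; exact: H.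
exists g; apply: eq_from_tnth => i; rewrite tnth_map.
have [j gj] := gG (tnth a i); apply: (Gfun _ _ _ j 0 gj).
rewrite /=; apply/(nthP (tnth a i, tnth a i)); exists i.
  by rewrite size1_zip !size_tuple.
by rewrite nth_zip ?size_tuple // -!tnth_nth.
Qed.

Lemma homogeneous_over (C : {fset M}) n (a b : n.-tuple M) : eqtp S C a b ->
  exists g : Aut S, map_tuple g a = b /\ {in C, g =1 id}.
Proof.
move=> /eqtpP /(_ _ (in_tuple C) (fun x => id)) /homogeneous[g gab].
have gi i := congr1 (fun t => tnth t i) gab.
exists g; split; first apply: eq_from_tnth => i.
  by have := gi (lshift _ i); rewrite !tnth_map !tnth_lshift.
move=> x /(@tnthP _ _ (in_tuple C))[i ->].
by have := gi (rshift _ i); rewrite !tnth_map !tnth_rshift.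
Qed.

End Homogeneity.

(** * Repulsive automorphisms *)

Section Repulsive.
Context (L : language) (M : countType) (S : structure L M).
Context (ind : {fset M} -> {fset M} -> {fset M} -> Prop).
Hypothesis CIR : canonical_independence_relation S ind.
Hypothesis homogeneous_over : forall (C : {fset M}) n (a b : n.-tuple M),
  eqtp S C a b -> exists g : Aut S, map_tuple g a = b /\ {in C, g =1 id}.
Local Open Scope fset_scope.
Local Notation "g @* A" := (aut_fun g @` A) (at level 24).
Implicit Types (g s t : Aut S) (A B C U V W X Z : {fset M}).

Lemma aut_inj g : injective g.
Proof. exact: can_inj (aut_invK g). Qed.

Lemma aut_invVK g : cancel (g^-1 : Aut S)%g g.
Proof. by move=> x; rewrite -aut_mulE mulgV. Qed.

Lemma mem_aut g A x : (g x \in g @* A) = (x \in A).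
Proof. by rewrite mem_imfset /=; last exact: aut_inj. Qed.

Lemma imaut1 A : (1%g : Aut S) @* A = A.
Proof.
by apply/fsetP => x; rewrite -[x in LHS]/((1%g : Aut S) x) mem_aut.
Qed.

Lemma imautM g s A : (g * s)%g @* A = g @* (s @* A).
Proof.
apply/fsetP => x; rewrite -[x](aut_invVK g) mem_aut.
rewrite -[(g^-1 : Aut S)%g x](aut_invVK s).
by rewrite -aut_mulE !mem_aut.
Qed.

Lemma imautK g A : (g^-1)%g @* (g @* A) = A.
Proof. by rewrite -imautM mulVg imaut1. Qed.

Lemma imautVK g A : g @* ((g^-1)%g @* A) = A.
Proof. by rewrite -imautM mulgV imaut1. Qed.

Lemma imautS g A B : A `<=` B -> g @* A `<=` g @* B.
Proof.
move=> /fsubsetP AB; apply/fsubsetP => _ /imfsetP[x /= xA ->].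
by rewrite mem_aut AB.
Qed.

Lemma eq_in_imaut g s A : {in A, g =1 s} -> g @* A = s @* A.
Proof. by move=> gs; exact: eq_in_imfset. Qed.

Lemma imaut_id g A : {in A, g =1 id} -> g @* A = A.
Proof. by move=> gA; rewrite (@eq_in_imaut g 1%g) ?imaut1. Qed.

(** Extension gives a copy of [s @* Z] over [s @* X] from which [Z] is independent. With [g] fixing
    [s @* X] and moving [s @* Z] to this copy, take [t = g * s]. *)
Lemma free_extension_forward s X Z :
  exists t, {in X, t =1 s} /\ ind Z (s @* X) (t @* Z).
Proof.
have [+ _] := cir_existence CIR Z (s @* X).
move=> /(cir_extension CIR (map_tuple s (in_tuple Z)))[d [dE Zd]].
have [g [gd gX]] := homogeneous_over (esym dE).
exists (g * s)%g; split.
  by move=> x xX; rewrite aut_mulE gX // fsetUid mem_aut.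
apply: (cir_monotonicity CIR Zd) => //.
apply/fsubsetP => _ /imfsetP[x /= xZ ->]; rewrite inE; apply/orP; right.
by rewrite inE -gd /= -map_comp; apply/mapP; exists x.
Qed.

(** Extension acts on the right only, so a copy of [Z] over [X] is made independent from the
    preimage of [Z] under [s]; then [g], fixing [X], moves the whole configuration so that the copy
    becomes [Z], and [t] is [s * g^-1]. *)
Lemma free_extension_backward s X Z :
  exists t, {in X, t =1 s} /\ ind ((t^-1)%g @* Z) X Z.
Proof.
have [+ _] := cir_existence CIR ((s^-1)%g @* Z) X.
move=> /(cir_extension CIR (in_tuple Z))[d [dE Zd]].
have [g [gd gX]] := homogeneous_over dE.
have {}gX x : x \in X -> g x = x by move=> xX; rewrite gX ?fsetUid.
exists (s * g^-1)%g; split.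
  by move=> x xX; rewrite aut_mulE -{1}(gX _ xX) aut_invK.
rewrite invgM invgK imautM -{1}(imaut_id gX).
apply: (cir_monotonicity CIR (cir_invariant CIR g Zd)) => //.
apply/fsubsetP => x xZ.
have : x \in tval (map_tuple g d) by rewrite gd.
move=> /mapP[y yd ->]; rewrite mem_aut inE; apply/orP; right.
by rewrite inE.
Qed.

Definition free_step s U V : Prop :=
  [/\ U `<=` V, s @* U `<=` V & ind V (s @* U) (s @* V)].

Lemma free_step_aut s i U V : free_step s U V ->
  free_step s ((s ^+ i)%g @* U) ((s ^+ i)%g @* V).
Proof.
move=> [UV sUV H]; split; first exact: imautS.
  by rewrite -imautM -expgS expgSr imautM; exact: imautS.
by rewrite -!imautM -!expgS !expgSr !imautM; exact: cir_invariant H.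
Qed.

Section FreeChain.
Context (s : Aut S) (W : nat -> {fset M}).
Hypothesis W0 : W 0 = fset0.
Hypothesis W_free : forall i, free_step s (W i) (W i.+1).

Lemma free_chain_mono i j : i <= j -> W i `<=` W j.
Proof.
move=> /subnK <-; elim: (j - i) => [|k IH]; first by rewrite add0n.
by rewrite addSn; apply: fsubset_trans IH _; have [] := W_free (k + i).
Qed.

(** Induction on [m] by transitivity on the right. The free step at [l] applies with base enlarged
    by [s @* W i], as this set is already contained in [s @* W l]. *)
Lemma free_chain_step i m : i < m -> ind (W i.+1) (s @* W i) (s @* W m).
Proof.
move=> /subnK <-; elim: (m - i.+1) => [|k IH].
  by rewrite add0n; have [] := W_free i.
rewrite addSn; set l := (k + i.+1)%N in IH *.
have il : i <= l by rewrite /l addnS leqW // leq_addl.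
have [_ _ H] := W_free l.
have H' : ind (W i.+1) (s @* W l `|` s @* W i) (s @* W l.+1).
  rewrite (fsetUidPl _ _ (imautS s (free_chain_mono il))).
  apply: (cir_monotonicity CIR H) => //.
  by apply: free_chain_mono; rewrite ltnS.
by apply: (cir_monotonicity CIR (cir_transitivity_right CIR H' IH)) => //;
  exact: fsubsetUl.
Qed.

(** Transitivity on the left through [(s ^+ r)%g @* W j.+1]. One half is the induction hypothesis at
    [j.+1] and [m.+1], using that [s] maps [W k] into [W k.+1]; the other is the image of
    [free_chain_step] under [s ^+ r]. *)
Lemma free_chain_pow r j m : (j + r <= m)%N ->
  ind (W (j + r)) ((s ^+ r)%g @* W j) ((s ^+ r)%g @* W m).
Proof.
elim: r j m => [|r IH] j m jm.
  rewrite expg0 addn0 !imaut1.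
  by have [_] := cir_existence CIR (W m) (W j).
have sW k : s @* W k `<=` W k.+1 by have [] := W_free k.
have H1 : ind (W (j + r.+1)) ((s ^+ r)%g @* W j.+1 `|` (s ^+ r.+1)%g @* W j)
    ((s ^+ r.+1)%g @* W m).
  rewrite expgSr !imautM (fsetUidPl _ _ (imautS _ (sW j))).
  have := IH j.+1 m.+1; rewrite addSnnS => /(_ (leqW jm)) H.
  by apply: (cir_monotonicity CIR H) => //; exact: imautS.
have H2 : ind ((s ^+ r)%g @* W j.+1) ((s ^+ r.+1)%g @* W j) ((s ^+ r.+1)%g @* W m).
  rewrite expgSr !imautM; apply: (cir_invariant CIR); apply: free_chain_step.
  by apply: leq_trans jm; rewrite addnS ltnS leq_addr.
apply: (cir_monotonicity CIR (cir_transitivity_left CIR H1 H2)) => //.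
exact: fsubsetUl.
Qed.

Lemma free_chain_independent r : ind (W r) fset0 ((s ^+ r)%g @* W r).
Proof.
have := @free_chain_pow r 0 r; rewrite W0 imfset0; exact.
Qed.

End FreeChain.

(* The last condition is [free_step t V (t @* X')] pulled back by [t], so that it
   only involves values of [t] on [X']. *)
Lemma repulsive_step s X c : exists t V X',
  [/\ {in X, t =1 s}, [/\ X `<=` V, V `<=` X' & V `<=` t @* X'], c \in V,
      free_step t X V & ind X' V (t @* X')].
Proof.
pose V := c |` (X `|` s @* X).
have [XV sXV] : X `<=` V /\ s @* X `<=` V.
  by split; apply/fsubsetP => x xX; rewrite !inE xX ?orbT.
have [s1 [s1s H1]] := free_extension_forward s X V.
(* The final set is the preimage of [Z] under [t]. The first summand puts [V] into its image; the
   second puts [V] into the set itself, since [t] agrees with [s1] on [V]. *)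
pose Z := V `|` s1 @* V.
have [t [ts1 H2]] := free_extension_backward s1 V Z.
have ts : {in X, t =1 s} by move=> x xX; rewrite ts1 ?s1s // (fsubsetP XV).
exists t, V, ((t^-1)%g @* Z); rewrite imautVK; split=> //.
- split=> //; last exact: fsubsetUl.
  rewrite -(imautK t V); apply: imautS; rewrite (eq_in_imaut ts1).
  exact: fsubsetUr.
- by rewrite !inE eqxx.
- by split; rewrite ?(eq_in_imaut ts) ?(eq_in_imaut ts1).
Qed.

Lemma repulsive_automorphism :
  exists s, forall A, exists r : nat, ind A fset0 ((s ^+ r)%g @* A).
Proof.
pose R (sX tY : Aut S * {fset M}) V (c : M) := let: (s, X) := sX in
  let: (t, Y) := tY in
  [/\ {in X, t =1 s}, [/\ X `<=` V, V `<=` Y & V `<=` t @* Y], c \in V,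
      free_step t X V & ind Y V (t @* Y)].
(* A point [c0] is needed as the value of [pt] at numbers that code no element, so the empty
   structure is treated apart. *)
have [c0|noM] := pselect (exists _ : M, True); last first.
  exists 1%g => A; exists 0; rewrite expg0 imaut1.
  have -> : A = fset0 by apply/fsetP => x; case: noM; exists x.
  by have [] := cir_existence CIR fset0 fset0.
have {c0} [c0 _] := c0.
have /choice[step hstep] : forall cX : M * (Aut S * {fset M}),
    exists tYV : (Aut S * {fset M}) * {fset M}, R cX.2 tYV.1 tYV.2 cX.1.
  move=> [c [s X]]; have [t [V [Y H]]] := repulsive_step s X c.
  by exists (t, Y, V).
pose pt i := odflt c0 (choice.unpickle i).
pose fix st i := if i is i'.+1 then (step (pt i', st i')).1 else (1%g : Aut S, fset0).
pose V i := (step (pt i, st i)).2.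
pose g i := (st i).1; pose X i := (st i).2.
have stP i : [/\ {in X i, g i.+1 =1 g i},
    [/\ X i `<=` V i, V i `<=` X i.+1 & V i `<=` g i.+1 @* X i.+1], pt i \in V i,
    free_step (g i.+1) (X i) (V i) & ind (X i.+1) (V i) (g i.+1 @* X i.+1)].
  have := hstep (pt i, st i).
  rewrite /R /g /X /V /=; case: (st i) => s Y /=.
  by case: (step _) => [[t Z] U] /=.
have XS i : {subset X i <= X i.+1}.
  by have [_ [/fsubsetP H1 /fsubsetP H2 _] _ _ _] := stP i; move=> x /H1/H2.
have Xmono i j : i <= j -> {subset X i <= X j}.
  move=> /subnK <-; elim: (j - i) => // k IH x /IH.
  by rewrite addSn; exact: XS.
have ptP x : pt (choice.pickle x) = x by rewrite /pt choice.pickleK.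
have Xcov x : exists i, x \in X i.
  exists (choice.pickle x).+1.
  have [_ [_ /fsubsetP H _] + _ _] := stP (choice.pickle x).
  by rewrite ptP => /H.
have [|y|f fg] := @chain_limit_aut _ _ _ g X XS _ Xcov.
- by move=> i x xi; have [-> //] := stP i.
- have [_ [_ _ /fsubsetP H] + _ _] := stP (choice.pickle y).
  rewrite ptP => /H /imfsetP[x /= xX ->].
  by exists (choice.pickle y).+1, x.
have fX i : f @* X i = g i @* X i by apply: eq_in_imaut; exact: fg.
have free1 i : free_step f (X i) (V i).
  have [_ [XV VX _] _ H _] := stP i.
  have fV : f @* V i = g i.+1 @* V i.
    by apply: eq_in_imaut => x /(fsubsetP VX); exact: fg.
  have fX' : f @* X i = g i.+1 @* X i.
    by apply: eq_in_imaut => x /XS; exact: fg.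
  by rewrite /free_step fV fX'.
have free2 i : free_step f (V i) (f @* X i.+1).
  have [_ [_ VX VgX] _ _ H] := stP i; rewrite -fX in VgX H.
  by split=> //; [exact: imautS|exact: cir_invariant H].
(* Each stage is a forward step followed by a shifted backward step. *)
pose U i := if odd i then V i./2 else X i./2.
pose W i := (f ^+ i./2)%g @* U i.
have Wfree i : free_step f (W i) (W i.+1).
  rewrite /W /U /= uphalf_half; case: (odd i) => /=.
    by rewrite add1n expgSr imautM; apply: free_step_aut.
  by rewrite add0n; apply: free_step_aut.
have W0 : W 0 = fset0 by rewrite /W /U /= imfset0.
exists f => A.
have [|i Ai] := @common_index A (fun x i => val x \in X i) _ (fun x => Xcov (val x)).
  by move=> x i j /Xmono; apply.
(* [W i.*2] is the image of [X i] under [f ^+ i]; undoing this shift leaves [X i] independent from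
   its image under [f ^+ i.*2]. *)
exists i.*2; have := free_chain_independent W0 Wfree i.*2.
rewrite /W /U odd_double doubleK => /(cir_invariant CIR (f ^+ i)^-1%g).
rewrite imfset0 imautK -[(f ^+ i.*2)%g @* _]imautM.
rewrite -expgnDr addnC expgnDr imautM imautK.
have AX : A `<=` X i by apply/fsubsetP => x xA; exact: (Ai [` xA]).
by move=> H; apply: (cir_monotonicity CIR H) => //; exact: imautS.
Qed.

End Repulsive.

(** * The topology of automorphism groups *)

Section FreeAmalgam.
Context (L : language) (M : countType) (S : structure L M).
Context (ind : {fset M} -> {fset M} -> {fset M} -> Prop).
Hypothesis CIR : canonical_independence_relation S ind.
Hypothesis homogeneous : forall n (a b : n.-tuple M),
  elem_equiv S a b -> exists g : Aut S, map_tuple g a = b.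
Context (s : Aut S).
Local Open Scope fset_scope.
Hypothesis s_repulsive : forall A, exists r : nat,
  ind A fset0 (aut_fun (s ^+ r)%g @` A).

Lemma enumerates_imaut n (g : Aut S) (a : n.-tuple M) (A : {fset M}) :
  enumerates a A -> enumerates (map_tuple g a) (g @` A).
Proof.
move=> aA x; apply/mapP/imfsetP => -[y /= yA ->]; exists y => //.
  by rewrite -aA.
by rewrite aA.
Qed.

Lemma free_amalgam (I : finType) (u b : I -> Aut S) (E P : {fset M}) :
  exists (r : nat) (k : I -> Aut S), forall i, {in E, k i =1 u i} /\
    {in P, forall x, k i ((s ^+ r : Aut S)%g x) = (s ^+ r : Aut S)%g (b i x)}.
Proof.
pose uE := flatten [seq [seq u i x | x <- E] | i <- enum I].
pose bP := flatten [seq [seq b i x | x <- P] | i <- enum I].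
(* One finite set for all [i] at once, so that the exponent [r] does not depend on [i]. *)
pose Z := seq_fset tt (E ++ uE ++ P ++ bP).
have ZE x : (x \in Z) = [|| x \in E, x \in uE, x \in P | x \in bP].
  by rewrite seq_fsetE !mem_cat.
have EZ : E `<=` Z by apply/fsubsetP => x xE; rewrite ZE xE.
have PZ : P `<=` Z by apply/fsubsetP => x xP; rewrite ZE xP !orbT.
have uEZ i : u i @` E `<=` Z.
  apply/fsubsetP => _ /imfsetP[x /= xE ->]; rewrite ZE.
  apply/or4P/Or42/flatten_mapP; exists i.
    by rewrite mem_enum.
  exact: map_f.
have bPZ i : b i @` P `<=` Z.
  apply/fsubsetP => _ /imfsetP[x /= xE ->]; rewrite ZE.
  apply/or4P/Or44/flatten_mapP; exists i.
    by rewrite mem_enum.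
  exact: map_f.
have [r Zr] := s_repulsive Z; set t : Aut S := (s ^+ r)%g in Zr *.
suff /choice[k hk] : forall i, exists g : Aut S, {in E, g =1 u i} /\
    {in P, forall x, g (aut_fun t x) = aut_fun t (b i x)}.
  by exists r, k.
move=> i.
pose e := in_tuple E; pose p := in_tuple P.
have H1 : ind E fset0 (aut_fun t @` P).
  exact: (cir_monotonicity CIR Zr EZ (imautS t PZ)).
have H2 : ind (u i @` E) fset0 (aut_fun t @` (b i @` P)).
  exact: (cir_monotonicity CIR Zr (uEZ i) (imautS t (bPZ i))).
have eE : enumerates e E by [].
have pP : enumerates p P by [].
have := cir_stationarity CIR H1 H2 eE (enumerates_imaut t pP)
  (enumerates_imaut _ eE) (enumerates_imaut t (enumerates_imaut _ pP)).
have /eqtp0P E1 := elem_equiv_aut (u i) e.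
have /eqtp0P E2 : elem_equiv S (map_tuple t p) (map_tuple t (map_tuple (b i) p)).
  apply: elem_equiv_trans (elem_equiv_aut t _).
  apply: elem_equiv_trans (elem_equiv_aut (b i) p).
  exact: elem_equiv_sym (elem_equiv_aut t p).
move=> /(_ E1 E2) /eqtp0P /homogeneous[g hg]; exists g.
have gi j := congr1 (fun t => tnth t j) hg.
split=> x.
  move=> /(@tnthP _ _ e)[j ->].
  by have := gi (lshift _ j); rewrite !tnth_map !tnth_lshift !tnth_map.
move=> /(@tnthP _ _ p)[j ->].
by have := gi (rshift _ j); rewrite !tnth_map !tnth_rshift !tnth_map.
Qed.

End FreeAmalgam.

Section AutNbhs.
Context (L : language) (M : choiceType) (S : structure L M).

Let agree (X : Type) (F : {fset M} -> X -> Prop) : set_system X :=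
  [set U | exists E, forall h, F E h -> U h].

Let agree_filter (X : Type) (F : {fset M} -> X -> Prop) :
  (forall E E' h, {subset E <= E'} -> F E' h -> F E h) -> Filter (agree F).
Proof.
move=> Fsub; split.
- by exists fset0.
- move=> U V [E EU] [E' EV]; exists (E `|` E')%fset => h Fh.
  split; [apply: EU|apply: EV]; apply: Fsub Fh => x; rewrite inE => ->//.
  by rewrite orbT.
- by move=> U V UV [E EU]; exists E => h /EU/UV.
Qed.

Lemma nbhs_autP (g : Aut S) (U : set (Aut S)) :
  nbhs g U <-> exists E : {fset M}, forall h : Aut S, {in E, h =1 g} -> U h.
Proof.
split=> [|[E EU]]; last first.
  apply: filterS EU _.
  have : \forall h \near g, forall x, x \in (E : seq M) -> aut_fun h x = aut_fun g x.
    elim: (E : seq M) => [|x s IH]; first by near=> h.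
    near=> h => y; rewrite inE => /orP[/eqP ->|].
      by near: h; exact: near_aut.
    by move: y; near: h; exact: IH.
  by [].
(* The image of this filter in the function space converges to [g], which is checked one coordinate
   at a time; hence every neighbourhood of [g] contains a basic one. *)
pose F := agree (fun (E : {fset M}) (h : Aut S) => {in E, h =1 g}).
have FF : Filter F.
  by apply: agree_filter => E E' h EE' E'h x /EE'; exact: E'h.
rewrite nbhsE => -[_ [[C oC <-] /= Cg] CU].
have : set_val @ F --> (set_val g : {ptws M -> discrete_topology M}).
  apply/cvg_sup => x A [B [[D oD <-] /= Dx] sBA].
  exists [fset x]%fset => h hg; apply: sBA => /=.
  by move: Dx; rewrite -[set_val g x]/(aut_fun g x) -hg // inE.
have nC : nbhs (set_val g : {ptws M -> discrete_topology M}) C.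
  exact: open_nbhs_nbhs.
move=> /(_ _ nC) [E EC]; exists E => h hg.
by apply: CU; exact: EC.
Unshelve. all: by end_near. Qed.

Lemma nbhs_ptws_autP (I : finType) (g : {ptws I -> Aut S})
    (U : set {ptws I -> Aut S}) :
  nbhs g U <-> exists E : {fset M}, forall h : {ptws I -> Aut S},
    (forall i, {in E, h i =1 g i}) -> U h.
Proof.
split=> [|[E EU]]; last first.
  apply: filterS EU _.
  have Ni i : nbhs g (fun h : {ptws I -> Aut S} => {in E, h i =1 g i}).
    have N : nbhs (g i) [set k : Aut S | {in E, k =1 g i}].
      by apply/nbhs_autP; exists E.
    exact: (@ptws_eval_continuous (Aut S) I i g _ N).
  exact: (filter_forall (nbhs_filter g) Ni).
pose F := agree (fun (E : {fset M}) (h : {ptws I -> Aut S}) =>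
  forall i, {in E, h i =1 g i}).
have FF : Filter F.
  by apply: agree_filter => E E' h EE' E'h i x /EE'; exact: E'h.
have : F --> g.
  apply/cvg_sup => i A [B [[D oD <-] /= Dg] sBA].
  have /nbhs_autP[E ED] := open_nbhs_nbhs (conj oD Dg).
  by exists E => h hg; apply: sBA; apply: ED.
by move=> /(_ U).
Qed.

End AutNbhs.

Lemma expgzN_nat (G : groupType) (x : G) (r : nat) :
  expgz x (- (r%:Z)%R)%R = (x ^- r)%g.
Proof. by case: r => [|r] //=; rewrite invg1. Qed.

Lemma nowhere_dense_sub (X : topologicalType) (A B : set X) :
  A `<=` B -> nowhere_dense B -> nowhere_dense A.
Proof.
move=> AB B0; apply/seteqP; split=> // x Ax; rewrite -B0.
exact: interiorS (closure_subset AB) x Ax.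
Qed.

(** * Generic conjugates and Baire category *)

Section GenericConjugates.
Context (L : language) (M : countType) (S : structure L M).
Context (ind : {fset M} -> {fset M} -> {fset M} -> Prop).
Hypothesis CIR : canonical_independence_relation S ind.
Hypothesis homogeneous : forall n (a b : n.-tuple M),
  elem_equiv S a b -> exists g : Aut S, map_tuple g a = b.
Context (s : Aut S).
Hypothesis s_repulsive : forall A : {fset M}, exists r : nat,
  ind A fset0 (aut_fun (s ^+ r)%g @` A)%fset.
Context (I : finType) (H : topologicalGroupType) (act : H -> I -> Aut S).
Hypothesis act_nbhs : forall (g : H) (U : set H), nbhs g U <->
  exists E : {fset M}, forall h, (forall i, {in E, act h i =1 act g i}) -> U h.
Hypothesis actM : forall g h i, act (g * h)%g i = (act g i * act h i)%g.
Hypothesis act_surj : forall u : I -> Aut S, exists h, forall i, act h i = u i.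

Lemma act1 i : act 1%g i = 1%g.
Proof. by apply: (@mulgI _ (act 1%g i)); rewrite -actM !mulg1. Qed.

Lemma actX g r i : act (g ^+ r)%g i = (act g i ^+ r)%g.
Proof.
by elim: r => [|r IH]; [rewrite !expg0 act1|rewrite !expgS actM IH].
Qed.

Lemma actV g i : act (g^-1)%g i = (act g i)^-1%g.
Proof. by apply: (@mulgI _ (act g i)); rewrite -actM !mulgV act1. Qed.

Implicit Types (J : {ffun I -> seq (M * M)}).

Definition realizes J (h : H) : Prop :=
  forall i xy, xy \in J i -> act h i xy.1 = xy.2.

(** Some conjugate of [g] by a power of [s] realizes [J]. The set [E] contains the points where [g]
    is evaluated, which makes this an open condition on [g]. *)
Definition hits J (g : H) (E : {fset M}) : Prop :=
  exists r : nat, forall i xy, xy \in J i ->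
    (s ^+ r : Aut S)%g xy.1 \in E /\
    act g i ((s ^+ r : Aut S)%g xy.1) = (s ^+ r : Aut S)%g xy.2.

Lemma hits_stable J g h (E E' : {fset M}) : {subset E <= E'} ->
  (forall i, {in E, act h i =1 act g i}) -> hits J g E -> hits J h E'.
Proof.
move=> EE' gh [r gr]; exists r => i xy xyJ.
by have [xE gx] := gr i xy xyJ; rewrite (gh _ _ xE) (EE' _ xE).
Qed.

Lemma hits_extend J (h0 g : H) (E : {fset M}) : realizes J h0 ->
  exists h E', (forall i, {in E, act h i =1 act g i}) /\ hits J h E'.
Proof.
move=> h0J.
pose P := seq_fset tt (flatten [seq [seq xy.1 | xy <- J i] | i <- enum I]).
have [r [k hk]] :=
  free_amalgam CIR homogeneous s_repulsive (act g) (act h0) E P.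
have [h hh] := act_surj k.
exists h, (aut_fun (s ^+ r)%g @` P)%fset; split=> [i x xE|].
  by rewrite hh; have [-> //] := hk i.
exists r => i xy xyJ.
have xP : xy.1 \in P.
  rewrite seq_fsetE; apply/flatten_mapP; exists i; first by rewrite mem_enum.
  exact: map_f.
split; first by apply/imfsetP; exists xy.1.
by rewrite hh; have [_ ->//] := hk i; rewrite (h0J _ _ xyJ).
Qed.

Context (f : H).
Hypothesis act_f : forall i, act f i = s.

(** A nonempty open set contains all elements that agree with some [h0] on a finite [E]; the graph
    of [h0] on [E] is the pattern [J] to hit. *)
Lemma hits_all_dense g :
  (forall J h0, realizes J h0 -> exists E, hits J g E) ->
  dense [set (expgz f n * g * expgz f (- n)%R)%g | n in [set: int]].
Proof.
move=> ghits O [h0 Oh0] oO.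
have /act_nbhs[E EO] := open_nbhs_nbhs (conj oO Oh0).
pose J := [ffun i => [seq (x, act h0 i x) | x <- E]].
have [|E' [r hr]] := ghits J h0.
  by move=> i xy; rewrite ffunE => /mapP[x xE ->].
exists (f ^- r * g * f ^+ r)%g; split; last first.
  by exists (- (r%:Z)%R)%R => //; rewrite expgzN_nat GRing.opprK.
apply: EO => i x xE; rewrite !actM actV !actX act_f !aut_mulE.
have [|_ /= ->] := hr i (x, act h0 i x); last exact: aut_invK.
by rewrite ffunE; apply/mapP; exists x.
Qed.

(** The complement is covered by the countably many sets [miss J]. If [J] is realized, each basic
    open set contains by [hits_extend] a point hitting [J], and so do all points near it. *)
Lemma comeager_conjugates :
  comeager [set g : H |
    dense [set (expgz f n * g * expgz f (- n)%R)%g | n in [set: int]]].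
Proof.
set D := [set g | _].
pose miss J := [set g : H | (exists h0, realizes J h0) /\ ~ exists E, hits J g E].
have miss_nd J : nowhere_dense (miss J).
  apply/seteqP; split=> // g /act_nbhs[E EU].
  have [[h0 h0J]|nreal] := pselect (exists h0, realizes J h0); last first.
    have /EU/(_ setT filterT)[h [[]//]] : forall i, {in E, act g i =1 act g i} by [].
  have [h [E' [hg hE']]] := hits_extend g E h0J.
  have /act_nbhs nE' : exists E'' : {fset M}, forall k,
      (forall i, {in E'', act k i =1 act h i}) -> hits J k E'.
    by exists E' => k kh; exact: hits_stable hE'.
  by have [k [[_ nk] kE']] := EU h hg _ nE'; apply: nk; exists E'.
(* [meager] asks for equality with the union, hence the intersection with the complement of [D]. *)
exists (fun n => if choice.unpickle n is Some J then ~` D `&` miss J else set0).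
split=> [n|].
  case: choice.unpickle => [J|]; first exact: nowhere_dense_sub (miss_nd J).
  by rewrite /nowhere_dense closure0 interior0.
apply/seteqP; split=> [g nDg|g [n _]]; last first.
  by case: choice.unpickle => // J [].
have [J [h0 [h0J ng]]] : exists J h0, realizes J h0 /\ ~ exists E, hits J g E.
  apply: contrapT => nJ; apply: nDg; apply: hits_all_dense => J h0 h0J.
  by apply: contrapT => ng; apply: nJ; exists J, h0.
exists (choice.pickle J) => //; rewrite choice.pickleK.
by split=> //; split=> //; exists h0.
Qed.

(** A direct Baire construction of a point. Task [inl c] puts [c] into the domain and into the range
    of every coordinate; task [inr J] hits [J] if it is realized at all. *)
Lemma exists_generic : exists g : H,
  forall J h0, realizes J h0 -> exists E, hits J g E.
Proof.
pose task := (M + {ffun I -> seq (M * M)})%type.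
have /choice[step hstep] : forall nuE : nat * (H * {fset M}),
    exists vF : H * {fset M},
    [/\ {subset nuE.2.2 <= vF.2},
        forall i, {in nuE.2.2, act vF.1 i =1 act nuE.2.1 i},
        forall c, choice.unpickle nuE.1 = Some (inl c : task) ->
          c \in vF.2 /\ forall i, exists x, x \in vF.2 /\ act vF.1 i x = c &
        forall J h0, choice.unpickle nuE.1 = Some (inr J : task) -> realizes J h0 ->
          hits J vF.1 vF.2].
  move=> [n [u E]] /=; case: (choice.unpickle n) => [[c|J]|].
  - pose F := seq_fset tt (c :: E ++ [seq ((act u i)^-1 : Aut S)%g c | i <- enum I]).
    exists (u, F); split=> //= [x xE|c' [<-]].
      by rewrite seq_fsetE inE mem_cat xE orbT.
    split=> [|i]; first by rewrite seq_fsetE inE eqxx.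
    exists (((act u i)^-1 : Aut S)%g c); split; last exact: aut_invVK.
    rewrite seq_fsetE inE mem_cat; apply/orP; right; apply/orP; right.
    by apply/mapP; exists i; rewrite ?mem_enum.
  - have [[h0 h0J]|nreal] := pselect (exists h0, realizes J h0); last first.
      exists (u, E); split=> //= J' h0 [<-] h0J.
      by case: nreal; exists h0.
    have [h [E' [hu hE']]] := hits_extend u E h0J.
    exists (h, (E `|` E')%fset); split=> //= [x xE|J' h1 [<-] _].
      by rewrite inE xE.
    by apply: hits_stable hE' => // x xE'; rewrite inE xE' orbT.
  - by exists (u, E); split.
pose fix st n : H * {fset M} := if n is m.+1 then step (m, st m) else (1%g, fset0).
have stP n := hstep (n, st n).
have Esub n : {subset (st n).2 <= (st n.+1).2} by have [] := stP n.
have covs c : exists n, c \in (st n).2 /\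
    forall i, exists x, x \in (st n).2 /\ act (st n).1 i x = c.
  exists (choice.pickle (inl c : task)).+1.
  have [_ _ h _] := stP (choice.pickle (inl c : task)).
  by apply: h; rewrite choice.pickleK.
have /choice[v hv] : forall i, exists v : Aut S, forall n x, x \in (st n).2 ->
    v x = act (st n).1 i x.
  move=> i; apply: (chain_limit_aut (g := fun n => act (st n).1 i)) => //.
  - by move=> n x xn; have [_ h _ _] := stP n; exact: h.
  - by move=> c; have [n [? _]] := covs c; exists n.
  - by move=> c; have [n [_ /(_ i)[x ?]]] := covs c; exists n, x.
have [g hg] := act_surj v; exists g => J h0 h0J.
pose n := choice.pickle (inr J : task).
exists (st n.+1).2; have [_ _ _ h] := stP n.
have /h/(_ h0J) : choice.unpickle n = Some (inr J : task).
  exact: choice.pickleK.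
by apply: hits_stable => // i x xn; rewrite hg; exact: (hv i n.+1).
Qed.

Lemma conjugates_dense : cyclically_dense_conjugacy_class H /\
  exists f : H, comeager [set g : H |
    dense [set (expgz f n * g * expgz f (- n)%R)%g | n in [set: int]]].
Proof.
split; last by exists f; exact: comeager_conjugates.
have [g gP] := exists_generic; exists f, g.
(* The two forms of conjugation differ by the sign of the exponent. *)
congr dense: (hits_all_dense gP); apply/seteqP; split=> _ [n _ <-];
  by exists (- n)%R => //; rewrite GRing.opprK.
Qed.

End GenericConjugates.

Theorem corollary3p14 (L : language) (T : theory L) (M : countType)
    (S : structure L M) (T_categorical : omega_categorical T)
    (S_models_T : models S T) (S_CIR : has_CIR S) :
  (cyclically_dense_conjugacy_class (Aut S) /\
   exists f : Aut S,
     comeager [set g : Aut S |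
       dense [set (expgz f n * g * expgz f (- n)%R)%g | n in [set: int]]]) /\
  (forall k : nat,
     cyclically_dense_conjugacy_class {ptws 'I_k -> Aut S} /\
     exists f : {ptws 'I_k -> Aut S},
       comeager [set g : {ptws 'I_k -> Aut S} |
         dense [set (expgz f n * g * expgz f (- n)%R)%g | n in [set: int]]]).
Proof.
have [ind CIR] := S_CIR.
have extend := elem_equiv_extend T_categorical S_models_T.
have [s s_rep] := repulsive_automorphism CIR (homogeneous_over extend).
split=> [|k].
  (* The group itself is the case of a one-point index set. *)
  apply: (conjugates_dense CIR (homogeneous extend) s_rep
    (I := unit) (act := fun g _ => g) _ _ _ (f := s)) => //.
  - move=> g U; rewrite nbhs_autP; split=> -[E EU]; exists E => h hg.
      by apply: EU; exact: hg tt.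
    by apply: EU => _.
  - by move=> u; exists (u tt) => -[].
(* The constant family [s] serves as [f]: the same power of [s] then conjugates every coordinate. *)
apply: (conjugates_dense CIR (homogeneous extend) s_rep
  (act := fun (g : {ptws 'I_k -> Aut S}) i => g i) _ _ _ (f := fun=> s)) => //.
- exact: nbhs_ptws_autP.
- by move=> u; exists u.
Qed.
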